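(* Consider a sequence of multi-indices $\bm n=(n_1,\dots,n_r)\in\mathbb N^r$ with $|\bm n|\to\infty$, and let $\alpha_{\bm n}>-1$ be such that $$\lim_{|\bm n|\to\infty}\frac{\alpha_{\bm n}}{|\bm n|}=A\ge0,\qquad \lim_{|\bm n|\to\infty}\frac{n_j}{|\bm n|}=\theta_j>0,\quad j=1,\dots,r.$$ Let $\bm c_{\bm n}=(c_1^{(\bm n)},\dots,c_r^{(\bm n)})\in\mathbb R_{>0}^r$, with $c_j^{(\bm n)}\neq c_k^{(\bm n)}$ for $j\neq k$, be such that the limit $$\lim_{\bm n}\bm c_{\bm n}=\bm c=(c_1,\dots,c_r)\in\mathbb R_{>0}^r$$ exists, with $c_j\neq c_k$ for $j\neq k$. Fix $i\in\{1,\dots,r\}$. Then the Cauchy transform $y=\mathcal G_\mu(u)$ of the limiting distribution $\mu$ of the zeros of the rescaled Type I multiple Laguerre polynomials of the second kind $\mathcal L^{(\alpha_{\bm n},\bm c_{\bm n})}_{\bm n,i}(n_i\,x)$ satisfies the equation $$u=\frac1y-\frac{A+1}{\theta_i(y-c_i)}+\sum_{\substack{1\le j\le r\\ j\neq i}}\frac{\theta_j}{\theta_i(y-c_i+c_j)}.$$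
   Context: $\mathbb N=\{1,2,\dots\}$, $|\bm n|=n_1+\dots+n_r$. Type I multiple Laguerre polynomials of the second kind: for $\alpha>-1$ and $\bm c\in\mathbb R_{>0}^r$ with distinct entries, $(\mathcal L^{(\alpha,\bm c)}_{\bm n,1},\dots,\mathcal L^{(\alpha,\bm c)}_{\bm n,r})$ is the (unique) vector of polynomials with $\deg\mathcal L^{(\alpha,\bm c)}_{\bm n,j}\le n_j-1$ such that $Q(x)=\sum_{j=1}^r\mathcal L^{(\alpha,\bm c)}_{\bm n,j}(x)\,x^{\alpha}e^{-c_jx}$ satisfies $\int_0^{+\infty}Q(x)x^k\,dx=0$ for $0\le k\le|\bm n|-2$ and $\int_0^{+\infty}Q(x)x^{|\bm n|-1}dx=1$. For a polynomial $p$ of degree $m$ with zeros $\lambda_1,\dots,\lambda_m\in\mathbb C$ (with multiplicity), the normalized zero-counting measure is $\chi(p)=\frac1m\sum_{j}\delta_{\lambda_j}$. The limiting distribution $\mu$ is any weak-* accumulation point of the zero-counting measures of the rescaled polynomials (they converge in moments). The Cauchy transform is $\mathcal G_\mu(u)=\int\frac{d\mu(v)}{u-v}$, and the equation is understood in a neighborhood of $u=\infty$. *)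

(* Defs.v *)
From HB Require Import structures.
From mathcomp Require Import all_boot all_order all_algebra.
From mathcomp Require Import all_classical all_reals all_analysis.
From mathcomp Require Export complex.

Set Implicit Arguments.
Unset Strict Implicit.
Unset Printing Implicit Defensive.

Import Order.TTheory GRing.Theory Num.Theory.
Import numFieldNormedType.Exports.

Local Open Scope classical_set_scope.
Local Open Scope ring_scope.
Local Open Scope complex_scope.

Definition multi_size (r : nat) (n : 'I_r -> nat) : nat := (\sum_j n j)%N.

(* [size (L j) <= n j] encodes [deg (L j) <= n j - 1]. The integrals converge
   absolutely when [alpha > -1] and all [c j > 0]; the origin is excluded from
   the domain because of the convention chosen by [powR] for [0 `^ alpha]. *)
Definition is_typeI_laguerre2 (R : realType) (r : nat) (alpha : R)
    (c : 'I_r -> R) (n : 'I_r -> nat) (L : 'I_r -> {poly R}) : Prop :=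
  let Q x := \sum_j (L j).[x] * (x `^ alpha * expR (- c j * x)) in
  let moment k :=
    (\int[lebesgue_measure]_(x in `]0%R, +oo[) (Q x * x ^+ k)%:E)%E in
  [/\ forall j, (size (L j) <= n j)%N,
      forall k, (k.+2 <= multi_size n)%N -> moment k = 0%E &
      moment (multi_size n).-1 = 1%E].

(* Measures on the complex plane live on [R * R] with its product (i.e. Borel)
   sigma-algebra, the point [(a, b)] standing for [a + i b]. *)
Definition to_C (R : realType) (v : (R * R)%type) : R[i] := v.1 +i* v.2.

Definition to_plane (R : realType) (z : R[i]) : (R * R)%type :=
  (complex.Re z, complex.Im z).

(* the zeros of a nonzero polynomial, repeated according to multiplicity *)
Definition zeros (R : realType) (p : {poly R[i]}) : seq R[i] :=
  sval (closed_field_poly_normal p).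

Definition zero_counting (R : realType) (p : {poly R[i]}) :
    {measure set (R * R)%type -> \bar R} :=
  mscale (((size (zeros p))%:R^-1)%:nng : {nonneg R})
    (msum (fun k => dirac (to_plane (zeros p)`_k)) (size (zeros p))).

Definition test_function (R : realType) (f : (R * R)%type -> R) : Prop :=
  continuous f /\
  exists2 K : set (R * R)%type, compact K & forall v, ~ K v -> f v = 0.

(* [mu] is a cluster point of [nu] in the topology generated by the functionals
   [mu |-> \int f dmu], for [f] continuous with compact support. No
   normalization of [mu] is required. *)
Definition weak_star_accumulation (R : realType)
    (nu : nat -> {measure set (R * R)%type -> \bar R})
    (mu : {finite_measure set (R * R)%type -> \bar R}) : Prop :=
  forall (m : nat) (f : 'I_m -> (R * R)%type -> R),
    (forall l, test_function (f l)) ->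
  forall e : R, 0 < e -> forall N : nat,
  exists2 k, (N <= k)%N & forall l,
    `| \int[nu k]_v f l v - \int[mu]_v f l v | < e.

Definition cauchy_kernel (R : realType) (u : R[i]) (v : (R * R)%type) : R[i] :=
  (u - to_C v)^-1.

Definition cauchy_integrable (R : realType)
    (mu : {finite_measure set (R * R)%type -> \bar R}) (u : R[i]) : Prop :=
  mu.-integrable setT (fun v => (complex.Re (cauchy_kernel u v))%:E) /\
  mu.-integrable setT (fun v => (complex.Im (cauchy_kernel u v))%:E).

(* meaningful when [cauchy_integrable mu u] *)
Definition cauchy_transform (R : realType)
    (mu : {finite_measure set (R * R)%type -> \bar R}) (u : R[i]) : R[i] :=
  (\int[mu]_v complex.Re (cauchy_kernel u v)) +i*
  (\int[mu]_v complex.Im (cauchy_kernel u v)).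

Definition complex_poly (R : realType) (p : {poly R}) : {poly R[i]} :=
  map_poly (real_complex R) p.

(* Main.v *)
Require Import Defs.
From HB Require Import structures.
From mathcomp Require Import all_boot all_order all_algebra.
From mathcomp Require Import all_classical all_reals all_analysis.
From mathcomp Require Import measurable_realfun ring lra.

(* Write N = |n| and M = n_i - 1.  Pairing the orthogonality relations with the
   multiples of prod_{j != i} (t - c_j)^{n_j} isolates the i-th polynomial and
   shows that, up to a nonzero factor, it is g(-d/dx) x^M with
     g(w) = (c_i + w)^(alpha + N - 1) * prod_{j != i} (c_i - c_j + w)^(- n_j),
   a series that enters only through g' = (sum_j beta_j / (e_j + w)) g.
   For the rescaled Appell sequence P_m = g(- n_i^-1 d/dx) x^m this equation
   becomes
     x P_m = P_{m+1} + n_i^-1 sum_j beta_j S_{j,m},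
     e_j S_{j,m} = P_m + (m / n_i) S_{j,m-1}.
   For |x| large these recurrences give, by induction on m, P_m(x) != 0 and
   |P_{m-1}/P_m| small: the zeros are uniformly bounded.  Moreover
   P_{M-1}/P_M is the Cauchy transform of the zero-counting measure of P_M, the
   ratios P_{m-1}/P_m vary slowly with m, and along a subsequence on which
   P_{M-1}/P_M -> y the quotients S_{j,M-1}/P_{M-1} tend to 1/(e_j - y), so that
   x y = 1 + y sum_j b_j / (e_j - y), where b_j is the limit of beta_j / n_i. *)

Import Order.TTheory GRing.Theory Num.Theory.
Import numFieldNormedType.Exports.
Import ComplexField.Normc.

Local Open Scope classical_set_scope.
Local Open Scope ring_scope.
Local Open Scope complex_scope.

(** * Truncated power series *)

Section Truncation.
Context {F : fieldType}.
Implicit Types (f g h : {poly F}) (m : nat).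

(** S_{j,m} is the Appell polynomial of the series g / (e_j + w). Adjoining these r series closes
    the equation for g' into finitely many linear recurrences, whose coefficients converge once
    scaled by n_i. Only the first M + 1 coefficients of g act on x^M, and orthogonality controls
    exactly these, so series are handled as polynomials modulo a power of the variable.

    P_{M-1} / P_M is a Cauchy transform because P_m' = m P_{m-1}. There is an eps with |e_j| >= eps
    for all j, and |P_{m-1} / P_m| <= eps / 2 for |x| large. With s_m = S_{j,m} / P_m the second
    recurrence reads e_j s_m = 1 + (m / n_i) (P_{m-1} / P_m) s_{m-1}, which contracts by 1/2 and has
    limiting fixed point 1 / (e_j - y). Hence a bounded number of descents from M - 1 fixes s_{M-1}
    up to a small error, and at those indices m / n_i is close to 1.

    As mu is only a cluster point, the subsequence is chosen separately for each u. Test functions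
    have compact support; the uniform bound on the zeros confines mu to a bounded set and lets a
    truncated kernel replace 1 / (u - v). *)

Definition eqmodX m f g := forall k, (k < m)%N -> f`_k = g`_k.

Lemma eqmodX_refl m f : eqmodX m f f. Proof. by []. Qed.

Lemma eqmodX_sym m f g : eqmodX m f g -> eqmodX m g f.
Proof. by move=> fg k km; rewrite fg. Qed.

Lemma eqmodX_trans m f g h : eqmodX m f g -> eqmodX m g h -> eqmodX m f h.
Proof. by move=> fg gh k km; rewrite fg// gh. Qed.

Lemma eqmodX_leq m m' f g : (m <= m')%N -> eqmodX m' f g -> eqmodX m f g.
Proof. by move=> mm' fg k km; rewrite fg// (leq_trans km). Qed.

Lemma eqmodXD m f f' g g' :
  eqmodX m f f' -> eqmodX m g g' -> eqmodX m (f + g) (f' + g').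
Proof. by move=> ff gg k km; rewrite !coefD ff// gg. Qed.

Lemma eqmodXM m f f' g g' :
  eqmodX m f f' -> eqmodX m g g' -> eqmodX m (f * g) (f' * g').
Proof.
move=> ff gg k km; rewrite !coefM; apply: eq_bigr => -[j /= jk] _.
by rewrite ff ?gg// ?(leq_ltn_trans (leq_subr _ _))// (leq_ltn_trans _ km).
Qed.

Lemma eqmodXZ m a f g : eqmodX m f g -> eqmodX m (a *: f) (a *: g).
Proof. by move=> fg k km; rewrite !coefZ fg. Qed.

Lemma eqmodX_sum m (I : Type) (s : seq I) (P : pred I) (f g : I -> {poly F}) :
  (forall i, P i -> eqmodX m (f i) (g i)) ->
  eqmodX m (\sum_(i <- s | P i) f i) (\sum_(i <- s | P i) g i).
Proof. by move=> fg k km; rewrite !coef_sum; apply: eq_bigr => i /fg ->. Qed.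

Lemma eqmodX_deriv m f g : eqmodX m.+1 f g -> eqmodX m f^`() g^`().
Proof. by move=> fg k km; rewrite !coef_deriv fg. Qed.

(** Strong induction on the index: in coefficient k of [f * g] every term except f_0 g_k contains an
    earlier coefficient of [g], already known to vanish. *)
Lemma eqmodX_mul0 m f g : f`_0 != 0 -> eqmodX m (f * g) 0 -> eqmodX m g 0.
Proof.
move=> f0 fg0 k; elim/ltn_ind: k => k IH km.
have := fg0 k km; rewrite coefM big_ord_recl/= subn0 big1 ?addr0; last first.
  move=> [j /= jk] _; rewrite /bump/= add1n IH ?coef0 ?mulr0//.
    by rewrite subnSK// leq_subr.
  by rewrite (leq_ltn_trans (leq_subr _ _)).
by move/eqP; rewrite coef0 mulf_eq0 (negbTE f0) => /eqP.
Qed.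

Lemma eqmodX_mulI m f g h :
  f`_0 != 0 -> eqmodX m (f * g) (f * h) -> eqmodX m g h.
Proof.
move=> f0 fgh k km; apply/eqP; rewrite -subr_eq0 -coefB.
rewrite (@eqmodX_mul0 m f (g - h))// ?coef0// => j jm.
by rewrite mulrBr coefB fgh// subrr coef0.
Qed.

(** The truncated geometric series of 1 / (X + e). *)
Definition invXD m (e : F) : {poly F} := \poly_(k < m) ((- 1) ^+ k / e ^+ k.+1).

Lemma coefXaddCM (e : F) f k :
  (('X + e%:P) * f)`_k = e * f`_k + (if k is j.+1 then f`_j else 0).
Proof. by rewrite mulrDl coefD coefCM coefXM addrC; case: k. Qed.

Lemma invXDE m e : e != 0 -> eqmodX m (('X + e%:P) * invXD m e) 1.
Proof.
move=> e0 [|k] km; rewrite coefXaddCM !coef_poly km coef1/=.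
  by rewrite addr0 expr0 expr1 mul1r divff.
by rewrite (ltnW km) [e ^+ k.+2]exprS [(-1) ^+ k.+1]exprS; field; rewrite expf_neq0 ?e0.
Qed.

Lemma invXD_uniq m e f g : e != 0 ->
  eqmodX m (('X + e%:P) * f) g -> eqmodX m f (invXD m e * g).
Proof.
move=> e0 fg.
have fgi := eqmodXM _ _ _ _ _ (eqmodX_refl m (invXD m e)) fg.
apply: eqmodX_trans fgi; apply: eqmodX_sym.
rewrite mulrA -[X in eqmodX _ _ X]mul1r; apply: eqmodXM => //.
by rewrite mulrC; exact: invXDE.
Qed.

(* Up to the factor [c `^ (- gam)], the series of [(c + 'X) `^ (- gam)]. *)
Definition rising (gam : F) k := \prod_(j < k) (gam + j%:R).

Definition negbin T (c gam : F) : {poly F} :=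
  \poly_(k < T) ((- 1) ^+ k * rising gam k / (k`!%:R * c ^+ k)).

Lemma risingSr gam k : rising gam k.+1 = rising gam k * (gam + k%:R).
Proof. by rewrite /rising big_ord_recr. Qed.

Lemma risingSl gam k : rising gam k.+1 = gam * rising (gam + 1) k.
Proof.
rewrite /rising big_ord_recl addr0; congr (_ * _); apply: eq_bigr => j _.
by rewrite lift0 -natr1; ring.
Qed.

Lemma risingD gam k m : rising gam (k + m) = rising gam k * rising (gam + k%:R) m.
Proof.
elim: m => [|m IH]; first by rewrite addn0 /rising big_ord0 mulr1.
by rewrite addnS !risingSr IH natrD; ring.
Qed.

End Truncation.

(** * Binomial series with real exponent, and moments as coefficients of products *)

Section NegBin.
Context {R : numFieldType}.
Implicit Types (c gam : R) (f g : {poly R}).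

Lemma factS_neq0 k : (k`!%:R : R) != 0.
Proof. by rewrite pnatr_eq0 -lt0n fact_gt0. Qed.

(** [negbin] has constant term 1, so it stands for (1 + X / c)^(-gam); the factor c on the right is
    X + c = c (1 + X / c). *)
Lemma negbinS T c gam : c != 0 ->
  eqmodX T (('X + c%:P) * negbin T c (gam + 1)) (c *: negbin T c gam).
Proof.
move=> c0 [|k] km; rewrite coefXaddCM coefZ !coef_poly km.
  by rewrite /rising !big_ord0 addr0.
rewrite (ltnW km) risingSr (risingSl gam) factS natrM -natr1.
rewrite [c ^+ _]exprS [(-1) ^+ _]exprS; field.
by rewrite factS_neq0 expf_neq0// c0 natr1 pnatr_eq0.
Qed.

(** The truncation order is T + 1 on both sides because differentiating loses one coefficient. *)
Lemma negbin_deriv T c gam : c != 0 ->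
  eqmodX T (('X + c%:P) * (negbin T.+1 c gam)^`()) (- gam *: negbin T.+1 c gam).
Proof.
move=> c0 k kT; rewrite coefXaddCM coefZ.
have -> : (if k is j.+1 then (negbin T.+1 c gam)^`()`_j else 0) =
    (negbin T.+1 c gam)`_k *+ k.
  by case: k kT => [//|k kT]; rewrite coef_deriv.
rewrite coef_deriv !coef_poly !ltnS kT (ltnW kT) risingSr factS natrM.
rewrite -[_ / _ *+ k]mulr_natl -[_ / _ *+ k.+1]mulr_natl.
rewrite [c ^+ k.+1]exprS [(-1) ^+ k.+1]exprS.
have := factS_neq0 k; have := expf_neq0 k c0.
have : k.+1%:R != 0 :> R by rewrite pnatr_eq0.
rewrite -natr1; move: (c ^+ k) (k`!%:R : R) ((-1) ^+ k) (rising gam k) (k%:R : R) => x y z t s s0 x0 y0.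
by field; rewrite x0 y0 c0 s0.
Qed.

Lemma negbinX T c gam d : c != 0 ->
  eqmodX T (('X + c%:P) ^+ d * negbin T c gam) (c ^+ d *: negbin T c (gam - d%:R)).
Proof.
move=> c0; elim: d => [|d IH]; first by rewrite !expr0 mul1r scale1r subr0.
rewrite exprS -mulrA.
apply: (eqmodX_trans _ _ _ _ (eqmodXM _ _ _ _ _ (eqmodX_refl _ _) IH)).
rewrite -scalerAr [c ^+ d.+1]exprSr -scalerA; apply: eqmodXZ.
have -> : gam - d%:R = gam - d.+1%:R + 1 by rewrite -natr1; ring.
exact: negbinS.
Qed.

(* [coefrev n l] collects the coefficients of the type I polynomial so that
   integrals against it become coefficients of Cauchy products. *)
Definition coefrev n (l : {poly R}) : {poly R} :=
  \poly_(k < n) ((- 1) ^+ (n.-1 - k) * (n.-1 - k)`!%:R * l`_(n.-1 - k)).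

(** [G] encodes a combination of normalized moments, the k-th one weighted by G_{N-1-k}. A monomial
    X^d of [G], with d = N - 1 - k, becomes (X + c)^d and lowers the exponent of the binomial series
    to gam + 1 + k; the m-th coefficient of that series is the rising factorial on the left, and its
    sign and m! are absorbed by [coefrev]. In this form a zero of [G] of order n at c makes the
    right-hand side vanish. *)
Lemma moment_coef n N T (l G : {poly R}) c gam :
  (0 < n)%N -> (n <= T)%N -> c != 0 -> (size G <= N)%N ->
  \sum_(m < n) l`_m * \sum_(k < N) G`_(N.-1 - k) * rising (gam + 1 + k%:R) m
     / c ^+ (m + k) =
  c ^- N.-1 * (coefrev n l * negbin T c (gam + N%:R) * (G \Po ('X + c%:P)))`_n.-1.
Proof.
case: n => // n _ nT c0; case: N => [|N] sG.
  move: sG; rewrite leqn0 size_poly_eq0 => /eqP ->.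
  by rewrite comp_poly0 mulr0 coef0 mulr0 big1// => m _; rewrite big_ord0 mulr0.
rewrite comp_polyE /= -mulrA.
rewrite (big_ord_widen N.+1 (fun k => G`_k *: ('X + c%:P) ^+ k))//.
rewrite !mulr_sumr coef_sum mulr_sumr.
under eq_bigr do rewrite mulr_sumr.
(* The moment index k is replaced by the degree N - 1 - k of the monomial; degrees beyond the size
   of [G] contribute nothing on either side. *)
rewrite exchange_big/= (reindex_inj rev_ord_inj)/= [RHS]big_mkcond/=.
apply: eq_bigr => -[k /= kN] _.
rewrite subSS subKn//.
case: ifPn => [ks|]; last first.
  rewrite -leqNgt => ks; rewrite big1// => m _.
  by rewrite (nth_default 0 ks) !mul0r mulr0.
rewrite -scalerAr -scalerAr coefZ.
rewrite (@eqmodXM _ n.+1 (coefrev n.+1 l) (coefrev n.+1 l)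
   (negbin T c (gam + N.+1%:R) * ('X + c%:P) ^+ k)
   (c ^+ k *: negbin T c (gam + N.+1%:R - k%:R)))//; last first.
  by rewrite mulrC; apply: eqmodX_leq nT _; exact: negbinX.
rewrite -[coefrev _ _ * (_ *: _)]scalerAr coefZ coefMr !mulr_sumr.
apply: eq_bigr => -[m /= mn] _; rewrite !coef_poly /= ltnS leq_subr subKn//.
rewrite (leq_trans mn nT) natrB; last exact: kN.
have -> : gam + N.+1%:R - k%:R = gam + 1 + (N%:R - k%:R) by rewrite -natr1; ring.
have -> : c ^+ (m + (N - k)) = c ^+ m * c ^+ N / c ^+ k.
  by rewrite exprD -mulrA -expfB_cond// (negbTE c0)/= add0n.
have s2 : (-1) ^+ m * (-1) ^+ m = 1 :> R by rewrite -expr2 sqrr_sign.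
have := factS_neq0 m; have := expf_neq0 m c0; have := expf_neq0 N c0.
have := expf_neq0 k c0.
move: (c ^+ k) (c ^+ N) (c ^+ m) (m`!%:R : R) ((-1) ^+ m) s2 (rising _ m) => x y z t s s2 r.
move: (l`_m) (G`_k) => u v x0 y0 z0 t0.
transitivity (s * s * (u * v * r * x / (z * y))); first by rewrite s2 mul1r; field; rewrite x0 y0 z0.
by field; rewrite t0 y0 z0.
Qed.
End NegBin.

(** * Type I orthogonality determines the logarithmic derivative *)

Section LogDerivative.
Context {R : numFieldType} {r : nat}.
Variables (c : 'I_r -> R) (n : 'I_r -> nat) (alpha : R) (i : 'I_r).
Let N := (\sum_j n j)%N.

(* These are the [e_j] and [beta_j] of the introduction. *)
Definition lshift_node j : R := if j == i then c i else c i - c j.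

Definition lshift_exp j : R := if j == i then alpha + N%:R - 1 else - (n j)%:R.

Hypotheses (n_gt0 : forall j, (0 < n j)%N) (c_neq0 : forall j, c j != 0)
  (c_inj : injective c).

Lemma lshift_node_neq0 j : lshift_node j != 0.
Proof.
rewrite /lshift_node; case: (eqVneq j i) => // ji.
by rewrite subr_eq0 (inj_eq c_inj) eq_sym.
Qed.

Variables (l : 'I_r -> {poly R}) (w : 'I_r -> R) (kap : R).
Hypotheses (w_neq0 : w i != 0) (kap_neq0 : kap != 0).
Hypothesis orth : forall k, (k < N)%N ->
  \sum_j w j * (\sum_(m < n j) (l j)`_m * rising (alpha + 1 + k%:R) m / c j ^+ (m + k))
  = kap *+ (k == N.-1).

Let N_gt0 : (0 < N)%N.
Proof. by rewrite /N (bigD1 i)//= ltn_addr. Qed.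

Let leqnN j : (n j <= N)%N.
Proof. by rewrite /N (bigD1 j)//= leq_addr. Qed.

Let B j := negbin N.+1 (c j) (alpha + N%:R).

(** The orthogonality relations are summed with weights G_{N-1-k}; only k = N - 1 has a nonzero
    right-hand side, and its weight is G_0. *)
Lemma orth_poly (G : {poly R}) : (size G <= N)%N ->
  \sum_j w j * (c j ^- N.-1 * (coefrev (n j) (l j) * B j * (G \Po ('X + (c j)%:P)))`_(n j).-1)
  = kap * G`_0.
Proof.
move=> sG.
under eq_bigr => j _ do
  rewrite -(moment_coef (n j) N N.+1 (l j) G (c j) alpha)// ?leqW//.
transitivity (\sum_(k < N) G`_(N.-1 - k) * (kap *+ (nat_of_ord k == N.-1))).
  under [RHS]eq_bigr => k _ do rewrite -orth// mulr_sumr.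
  rewrite exchange_big/=; apply: eq_bigr => j _.
  rewrite mulr_sumr; under eq_bigr do rewrite !mulr_sumr.
  rewrite exchange_big/=; apply: eq_bigr => k _.
  by rewrite !mulr_sumr; apply: eq_bigr => m _; ring.
have N1 : (N.-1 < N)%N by rewrite prednK.
rewrite (bigD1 (Ordinal N1))//= eqxx subnn mulr1n mulrC big1 ?addr0// => k kN.
by have /negbTE -> : nat_of_ord k != N.-1 by []; rewrite mulr0n mulr0.
Qed.

Let M := (n i).-1.
Let g := coefrev (n i) (l i).
Let E : {poly R} := \prod_(j | j != i) ('X + (lshift_node j)%:P) ^+ n j.

Lemma prod_node_neq0 : \prod_(j | j != i) (- c j) ^+ n j != 0.
Proof. by apply/prodf_neq0 => j _; rewrite expf_neq0// oppr_eq0. Qed.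

Lemma E0_neq0 : E`_0 != 0.
Proof.
rewrite -horner_coef0 /E horner_prod; apply/prodf_neq0 => j _.
by rewrite hornerE !hornerE expf_neq0// lshift_node_neq0.
Qed.

(** The test polynomial prod_{j != i} (X - c_j)^{n_j} (X - c_i)^s has degree at most N - 1 because s
    < n_i. Shifted by c_j it is divisible by X^{n_j}, so the term of index j in [orth_poly]
    vanishes; shifted by c_i it is X^s times [E], which moves the coefficient being read from M to M
    - s. *)
Lemma coef_gBE s : (s <= M)%N ->
  (g * B i * E)`_(M - s) =
    kap / w i * c i ^+ N.-1 * (\prod_(j | j != i) (- c j) ^+ n j) * (- c i) ^+ s.
Proof.
move=> sM.
pose G : {poly R} := (\prod_(j | j != i) ('X - (c j)%:P) ^+ n j) * ('X - (c i)%:P) ^+ s.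
have G0 : G`_0 = (\prod_(j | j != i) (- c j) ^+ n j) * (- c i) ^+ s.
  rewrite -horner_coef0 hornerM horner_prod horner_exp !hornerE.
  by congr (_ * _); apply: eq_bigr => j _; rewrite horner_exp !hornerE.
have sG : (size G <= N)%N.
  have -> : size G = ((\sum_(j | j != i) n j) + s).+1.
    rewrite size_Mmonic ?size_exp_XsubC ?addnS/=; last 2 first.
    - by apply/prodf_neq0 => j _; rewrite expf_neq0// polyXsubC_eq0.
    - by rewrite monic_exp// monicXsubC.
    rewrite size_prod; last by move=> j _; rewrite expf_neq0// polyXsubC_eq0.
    under eq_bigr do rewrite size_exp_XsubC -addn1.
    by rewrite big_split/= sum1_card -addSn addnK addSn.
  by rewrite [N](bigD1 i)//= addnC ltn_add2r (leq_ltn_trans sM)// /M prednK.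
have GX (d : 'I_r) : (G \Po ('X + (c d)%:P)) =
   \prod_(j | j != i) ('X + (c d - c j)%:P) ^+ n j * ('X + (c d - c i)%:P) ^+ s.
  rewrite /G comp_polyM rmorph_prod/= !rmorphXn/= rmorphB/= comp_polyX comp_polyC.
  rewrite polyCB addrA; congr (_ * _); apply: eq_bigr => j _.
  by rewrite rmorphXn/= rmorphB/= comp_polyX comp_polyC polyCB addrA.
have := orth_poly G sG; rewrite (bigD1 i)//= big1 => [|j ji]; last first.
  rewrite GX (bigD1 j)//= subrr addr0 -!mulrA (mulrCA (B j)) (mulrCA (coefrev _ _)) coefXnM.
  by rewrite prednK ?n_gt0// leqnn !mulr0.
rewrite addr0 GX// subrr addr0 G0 => h.
have EE : \prod_(j | j != i) ('X + (c i - c j)%:P) ^+ n j = E.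
  by apply: eq_bigr => j /negbTE ji; rewrite /lshift_node ji.
move: h; rewrite EE mulrA coefMXn -/M ltnNge sM/= => h.
have c0 := expf_neq0 N.-1 (c_neq0 i).
apply: (mulfI w_neq0); apply: (mulfI (invr_neq0 c0)).
rewrite mulrCA h; field.
by rewrite w_neq0 c0.
Qed.

Let H := g * B i * E.

Let lead := kap / w i * c i ^+ N.-1 * (\prod_(j | j != i) (- c j) ^+ n j).

Lemma lead_neq0 : lead != 0.
Proof. by rewrite /lead !mulf_neq0 ?invr_eq0 ?expf_neq0 ?prod_node_neq0. Qed.

(** Up to sign and a factorial, this is the coefficient of x^M in the i-th polynomial, which
    therefore has full degree n_i - 1. *)
Lemma coefrev0_neq0 : g`_0 != 0.
Proof.
have := coef_gBE M (leqnn _); rewrite subnn => h.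
have : H`_0 != 0.
  by rewrite h mulf_neq0 ?expf_neq0 ?oppr_eq0 ?c_neq0// lead_neq0.
by rewrite /H !coef0M !mulf_eq0 !negb_or => /andP[/andP[]].
Qed.

(** By [coef_gBE] the coefficients of [H] up to M are in geometric progression of ratio - 1 / c_i,
    as for a multiple of 1 / (X + c_i). *)
Lemma XaddC_H : eqmodX M.+1 (('X + (c i)%:P) * H) (c i * H`_0)%:P.
Proof.
case=> [|k] kM; rewrite coefXaddCM coefC/= ?addr0//.
rewrite -{1}(subKn (kM : (k.+1 <= M)%N)) coef_gBE ?leq_subr// .
have kM' : (k <= M)%N by exact: ltnW.
have := coef_gBE (M - k) (leq_subr _ _); rewrite subKn// => ->.
by rewrite -[(M - k)%N](@prednK) ?subn_gt0// -subnS exprS; ring.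
Qed.

(** Logarithmic differentiation of (X + c_i) g B_i E = constant: g' / g = - 1 / (X + c_i) - B_i' /
    B_i - E' / E. The second term is (alpha + N) / (X + c_i), which together with the first gives
    the exponent alpha + N - 1. The derivative costs one coefficient, hence the order M. *)
Lemma coefrev_logderiv (b : 'I_r -> {poly R}) :
  (forall j, eqmodX M.+1 (('X + (lshift_node j)%:P) * b j) g) ->
  eqmodX M g^`() (\sum_j lshift_exp j *: b j).
Proof.
move=> bg.
pose iv j := invXD M.+1 (lshift_node j).
have ivE j : eqmodX M.+1 (iv j * ('X + (lshift_node j)%:P)) 1.
  by rewrite mulrC; apply: invXDE; exact: lshift_node_neq0.
have bE j : eqmodX M.+1 (b j) (iv j * g).
  by apply: invXD_uniq (bg j); exact: lshift_node_neq0.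
have ei : lshift_node i = c i by rewrite /lshift_node eqxx.
have E' : eqmodX M E^`() (E * \sum_(j | j != i) (n j)%:R *: iv j).
  rewrite /E; elim/big_rec2: _ => [|j q p ji IH].
    by rewrite -polyC1 derivC mulr0.
  rewrite derivM mulrDr; apply: eqmodXD; last first.
    by rewrite -mulrA; apply: eqmodXM.
  rewrite mulrAC; apply: eqmodXM => //.
  rewrite deriv_exp derivD derivX derivC addr0 mul1r -mulr_natl -scaler_nat -scalerAr.
  rewrite -scalerAl mul1r; apply: eqmodXZ.
  rewrite -{2}(prednK (n_gt0 j)) exprSr -mulrA -[X in eqmodX _ X]mulr1.
  apply: eqmodXM => //; apply: eqmodX_sym; rewrite mulrC.
  exact: eqmodX_leq (leqnSn M) (ivE j).
have B' : eqmodX M (B i)^`() (B i * (- (alpha + N%:R) *: iv i)).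
  have := negbin_deriv N (c i) (alpha + N%:R) (c_neq0 i).
  rewrite -/(B i) => /(eqmodX_leq _ _ _ _ (leq_trans (leq_pred _) (leqnN i))) h.
  have c0 := c_neq0 i.
  apply: eqmodX_trans (invXD_uniq M (c i) _ _ c0 h) _.
  rewrite -!scalerAr mulrC; apply: eqmodXZ; apply: eqmodXM => //.
  rewrite /iv ei => k kM; by rewrite !coef_poly kM ltnS ltnW.
have dU : eqmodX M ((('X + (c i)%:P) * H)^`()) 0.
  by apply: eqmodX_trans (eqmodX_deriv _ _ _ XaddC_H) _; rewrite derivC.
pose S := \sum_(j | j != i) (n j)%:R *: iv j.
(* The identity is first obtained multiplied by B_i E, and before that by X + c_i as well; both
   factors have nonzero constant term and can be cancelled. *)
have key : eqmodX M (B i * E * g^`())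
  (B i * E * (((alpha + N%:R - 1) *: iv i - S) * g)).
  have X0 : ('X + (c i)%:P)`_0 != 0 by rewrite coefD coefX coefC/= add0r c_neq0.
  apply: (eqmodX_mulI _ _ _ _ X0).
  have -> : ('X + (c i)%:P) * (B i * E * g^`()) = (('X + (c i)%:P) * H)^`()
     - (1 * (B i * E * g) + ('X + (c i)%:P) * (((B i)^`() * E + B i * E^`()) * g)).
    rewrite /H !derivM derivD derivX derivC addr0; ring.
  have -> : ('X + (c i)%:P) * (B i * E * (((alpha + N%:R - 1) *: iv i - S) * g))
    = 0 + (-1) *: (iv i * ('X + (c i)%:P) * (B i * E * g) + ('X + (c i)%:P)
       * ((B i * (- (alpha + N%:R) *: iv i) * E + B i * (E * S)) * g)).
    by rewrite -!mul_polyC polyCB polyCN polyC1; ring.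
  rewrite -scaleN1r; apply: eqmodXD => //; apply: eqmodXZ; apply: eqmodXD.
    apply: eqmodXM => //; rewrite -ei; apply: eqmodX_sym.
    exact: eqmodX_leq (leqnSn M) (ivE i).
  by do 2! [apply: eqmodXM => //]; apply: eqmodXD; apply: eqmodXM => //.
have BE0 : (B i * E)`_0 != 0.
  rewrite coef0M mulf_neq0 ?E0_neq0// coef_poly/= /rising big_ord0.
  by rewrite fact0 !expr0 !mulr1 invr1 mulr1 oner_neq0.
apply: eqmodX_trans (eqmodX_mulI _ _ _ _ BE0 key) _.
have -> : ((alpha + N%:R - 1) *: iv i - S) * g =
    (alpha + N%:R - 1) *: (iv i * g) + (-1) *: (S * g).
  by rewrite -!mul_polyC polyCN polyC1; ring.
rewrite mulr_suml.
rewrite [X in eqmodX _ _ X](bigD1 i)//= [lshift_exp i]/lshift_exp eqxx.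
have leM := eqmodX_leq _ _ _ _ (leqnSn M).
apply: eqmodXD.
  by apply: eqmodXZ; apply: eqmodX_sym; exact: leM (bE i).
rewrite scaler_sumr; apply: eqmodX_sum => j /negbTE ji; rewrite /lshift_exp ji.
rewrite -scalerAl scalerA mulN1r; apply: eqmodXZ; apply: eqmodX_sym.
exact: leM (bE j).
Qed.

End LogDerivative.

(** * Appell polynomials *)

Section Appell.
Context {F : fieldType}.
Variable t : F.
Implicit Types (f g : {poly F}).

(* The differential operator [f(- t * d/dx)] applied to ['X^m]. *)
Definition appell f m : {poly F} :=
  \sum_(k < m.+1) (f`_k * (- t) ^+ k * (m ^_ k)%:R) *: 'X^(m - k).

Lemma eqmodX_appell f g m : eqmodX m.+1 f g -> appell f m = appell g m.
Proof. by move=> fg; apply: eq_bigr => -[k km] _ /=; rewrite fg. Qed.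

Lemma appellD f g m : appell (f + g) m = appell f m + appell g m.
Proof.
rewrite -big_split; apply: eq_bigr => k _ /=.
by rewrite coefD -scalerDl; congr (_ *: _); ring.
Qed.

Lemma appellZ a f m : appell (a *: f) m = a *: appell f m.
Proof.
rewrite scaler_sumr; apply: eq_bigr => k _.
by rewrite coefZ scalerA !mulrA.
Qed.

Lemma appell_sum (I : Type) (s : seq I) (P : pred I) (f : I -> {poly F}) m :
  appell (\sum_(j <- s | P j) f j) m = \sum_(j <- s | P j) appell (f j) m.
Proof.
elim/big_rec2: _ => [|j p q Pj <-]; last by rewrite appellD.
by rewrite /appell big1// => k _; rewrite coef0 !mul0r scale0r.
Qed.

Lemma appell0 f : appell f 0 = (f`_0)%:P.
Proof. by rewrite /appell big_ord1 expr0 !mulr1 alg_polyC. Qed.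

(** Multiplying the symbol by X composes the operator with - t D, where D = d/dx, and - t D sends
    x^(m+1) to - t (m + 1) x^m. *)
Lemma appell_mulX f m : appell ('X * f) m.+1 = - (t * m.+1%:R) *: appell f m.
Proof.
rewrite /appell big_ord_recl coefXM/= !mul0r scale0r add0r scaler_sumr.
apply: eq_bigr => k _; rewrite scalerA /bump add1n coefXM/= subSS ffactSS exprS natrM.
by congr (_ *: _); ring.
Qed.

(** Pascal's rule multiplied by (k + 1)!. *)
Lemma ffact_pascal m k : (k <= m)%N ->
  (m.+1 ^_ k.+1 = m ^_ k.+1 + k.+1 * m ^_ k)%N.
Proof.
move=> km; rewrite ffactSS ffactnSr [in RHS]mulnC -mulnDl.
by rewrite addnS subnK.
Qed.

(** The commutation rule f(- t D) x = x f(- t D) - t f'(- t D), applied to x^m. *)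
Lemma appellS f m : appell f m.+1 = 'X * appell f m - t *: appell f^`() m.
Proof.
rewrite /appell mulr_sumr scaler_sumr big_ord_recl/= expr0 ffactn0 !mulr1 subn0.
under eq_bigr => k _ do rewrite /bump add1n subSS ffact_pascal -1?ltnS//.
rewrite -sumrN [in RHS]big_ord_recl/= ffactn0 expr0 !mulr1 subn0.
rewrite -scalerAr -exprS -addrA; congr (_ + _).
under eq_bigr => k _ do rewrite natrD mulrDr scalerDl.
rewrite big_split/=; congr (_ + _).
  rewrite big_ord_recr/= ffact_small// mulr0 scale0r addr0.
  apply: eq_bigr => k _; rewrite /bump add1n -scalerAr -exprS; congr (_ *: 'X^_).
  by rewrite subnSK.
apply: eq_bigr => k _; rewrite -scaleNr scalerA coef_deriv -mulr_natr exprS natrM.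
by congr (_ *: _); ring.
Qed.

(** The operator commutes with differentiation: this is the Appell property. *)
Lemma deriv_appell f m : (appell f m.+1)^`() = m.+1%:R *: appell f m.
Proof.
rewrite /appell big_ord_recr/= subnn expr0 derivD -[in X in _ + X^`()]mul_polyC mulr1 derivC addr0.
rewrite raddf_sum scaler_sumr; apply: eq_bigr => -[k /= km] _.
rewrite derivZ derivXn subSn// -scaler_nat !scalerA; congr (_ *: _).
have : (m.+1 ^_ k * (m - k).+1)%:R = (m.+1 * m ^_ k)%:R :> F.
  by rewrite -subSn// -ffactnSr ffactSS.
by rewrite !natrM -mulrA => ->; ring.
Qed.

Lemma coef_appell f m k : (k <= m)%N ->
  (appell f m)`_(m - k) = f`_k * (- t) ^+ k * (m ^_ k)%:R.
Proof.
move=> km; rewrite /appell coef_sum (bigD1 (Ordinal (km : k < m.+1)%N))//=.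
rewrite coefZ coefXn eqxx mulr1 big1 ?addr0// => -[j /= jm].
rewrite -val_eqE/= => jk; rewrite coefZ coefXn eqn_sub2lE// eq_sym.
by rewrite (negbTE jk) mulr0.
Qed.

Lemma size_appell_leq f m : (size (appell f m) <= m.+1)%N.
Proof.
apply: leq_trans (size_sum _ _ _) _; apply/bigmax_leqP => k _.
by rewrite (leq_trans (size_scale_leq _ _))// size_polyXn ltnS leq_subr.
Qed.

Lemma size_appell f m : f`_0 != 0 -> size (appell f m) = m.+1.
Proof.
move=> f0; apply/eqP; rewrite eqn_leq size_appell_leq/=.
rewrite ltnNge; apply: contra f0 => /(nth_default 0) h.
by have := coef_appell f m 0 isT; rewrite subn0 h ffactn0 expr0 !mulr1 => <-.
Qed.

End Appell.

(** * Recurrences coming from a logarithmic derivative *)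

Section Value.
Context {F : fieldType} {r : nat}.
Variables (t x : F) (M : nat) (e beta : 'I_r -> F) (g : {poly F}) (b : 'I_r -> {poly F}).
Hypothesis bg : forall j, eqmodX M.+1 (('X + (e j)%:P) * b j) g.
Hypothesis gb : eqmodX M g^`() (\sum_j beta j *: b j).

Lemma appell_node j m : (m < M)%N ->
  appell t g m.+1 = e j *: appell t (b j) m.+1 - (t * m.+1%:R) *: appell t (b j) m.
Proof.
move=> mM; rewrite -(eqmodX_appell _ _ _ _ (eqmodX_leq _ _ _ _ (mM : (m.+2 <= M.+1)%N) (bg j))).
by rewrite mulrDl appellD appell_mulX mul_polyC appellZ scaleNr addrC.
Qed.

Lemma appell_node0 j : appell t g 0 = e j *: appell t (b j) 0.
Proof.
rewrite -(eqmodX_appell _ _ _ _ (eqmodX_leq _ _ _ _ (ltn0Sn _) (bg j))).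
by rewrite mulrDl appellD mul_polyC appellZ appell0 coefXM add0r.
Qed.

(** Only the coefficients of g' below M are known, so the last polynomial this reaches is the one of
    index M. *)
Lemma appell_step m : (m < M)%N ->
  appell t g m.+1 = 'X * appell t g m - t *: \sum_j beta j *: appell t (b j) m.
Proof.
move=> mM; rewrite appellS; congr (_ - _ *: _).
rewrite (eqmodX_appell _ _ _ _ (eqmodX_leq _ _ _ _ mM gb)) appell_sum.
by apply: eq_bigr => j _; rewrite appellZ.
Qed.

End Value.

(** * Limits and growth estimates in the complex plane *)

Section NormC.
Context {R : realType}.
Implicit Types (x y z : R[i]) (a : R).

Lemma normc_norm x : `|x| = (normc x)%:C.
Proof. by rewrite normc_def; case: x. Qed.

Lemma normc_ge0 x : 0 <= normc x.
Proof. by case: x => a b; rewrite /normc sqrtr_ge0. Qed.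

Lemma normc_eq0 x : (normc x == 0) = (x == 0).
Proof. by apply/eqP/eqP => [/eq0_normc//|->]; rewrite normc0. Qed.

Lemma normc_gt0 x : (0 < normc x) = (x != 0).
Proof. by rewrite lt_def normc_ge0 andbT normc_eq0. Qed.

Lemma normc_real a : normc a%:C = `|a|.
Proof. by rewrite /normc/= expr0n addr0 sqrtr_sqr. Qed.

Lemma normc_nat m : normc (m%:R : R[i]) = m%:R.
Proof. by rewrite -(rmorph_nat (real_complex R)) normc_real ger0_norm. Qed.

Lemma normcBC x y : normc (x - y) = normc (y - x).
Proof. by rewrite -opprB normcN. Qed.

Lemma normcB_ge x y : normc x - normc y <= normc (x - y).
Proof. by rewrite lerBlDr; apply: le_trans (le_normcD _ _); rewrite subrK. Qed.

Lemma normc_sum (I : Type) (s : seq I) (P : pred I) (f : I -> R[i]) :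
  normc (\sum_(i <- s | P i) f i) <= \sum_(i <- s | P i) normc (f i).
Proof.
elim/big_rec2: _ => [|i u v _ vu]; first by rewrite normc0.
by apply: le_trans (le_normcD _ _) _; rewrite lerD2l.
Qed.

Lemma Re_le_normc x : `|complex.Re x| <= normc x.
Proof.
by case: x => a b /=; rewrite -sqrtr_sqr ler_sqrt ?addr_ge0 ?sqr_ge0// lerDl sqr_ge0.
Qed.

Lemma Im_le_normc x : `|complex.Im x| <= normc x.
Proof.
by case: x => a b /=; rewrite -sqrtr_sqr ler_sqrt ?addr_ge0 ?sqr_ge0// lerDr sqr_ge0.
Qed.

Lemma normc_le_ReIm x : normc x <= `|complex.Re x| + `|complex.Im x|.
Proof.
have -> : x = (complex.Re x)%:C + 'i * (complex.Im x)%:C by case: x => a b; simpc.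
apply: le_trans (le_normcD _ _) _; rewrite normcM !normc_real.
have -> : normc 'i = 1 :> R by rewrite /normc expr0n expr1n add0r sqrtr1.
by rewrite mul1r; case: x => a b; simpc.
Qed.

End NormC.

Section ComplexLimits.
Context {R : realType}.
Implicit Types (u v : nat -> R[i]) (l : R[i]).

(** Stated through the real modulus, so that squeezing and limit arithmetic take place in [R]. *)
Definition ccvg u l := (fun k => normc (u k - l)) @ \oo --> (0 : R).

Lemma ccvg_le u l (a : nat -> R) :
  (\forall k \near \oo, normc (u k - l) <= a k) -> a @ \oo --> (0 : R) -> ccvg u l.
Proof.
move=> ua a0; apply: (squeeze_cvgr _ (cvg_cst 0) a0).
by near=> k; rewrite normc_ge0/=; near: k.
Unshelve. all: by end_near. Qed.

Lemma ccvg_cst l : ccvg (fun=> l) l.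
Proof. by rewrite /ccvg subrr normc0; exact: cvg_cst. Qed.

Lemma ccvgD u v l (l' : R[i]) : ccvg u l -> ccvg v l' -> ccvg (fun k => u k + v k) (l + l').
Proof.
move=> ul vl; apply: (@ccvg_le _ _ (fun k => normc (u k - l) + normc (v k - l'))).
  near=> k; apply: le_trans (le_normcD _ _); rewrite le_eqVlt; apply/orP; left.
  by apply/eqP; congr normc; ring.
by rewrite -[X in _ --> X](addr0 (0 : R)); exact: cvgD.
Unshelve. all: by end_near. Qed.

Lemma ccvgM u v l (l' : R[i]) : ccvg u l -> ccvg v l' -> ccvg (fun k => u k * v k) (l * l').
Proof.
move=> ul vl; apply: (@ccvg_le _ _ (fun k => normc (u k - l) * normc (v k - l')
   + normc l * normc (v k - l') + normc (u k - l) * normc l')).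
  near=> k; rewrite -!normcM.
  apply: (@le_trans _ _ (normc ((u k - l) * (v k - l') + l * (v k - l'))
    + normc ((u k - l) * l'))); last by rewrite lerD2r; exact: le_normcD.
  apply: le_trans (le_normcD _ _); rewrite le_eqVlt; apply/orP; left.
  by apply/eqP; congr normc; ring.
have -> : (0 : R) = 0 * 0 + normc l * 0 + 0 * normc l' by ring.
by apply: cvgD; [apply: cvgD|]; apply: cvgM => //; exact: cvg_cst.
Unshelve. all: by end_near. Qed.

Lemma ccvg_sum (I : Type) (s : seq I) (u : I -> nat -> R[i]) (l : I -> R[i]) :
  (forall i, ccvg (u i) (l i)) ->
  ccvg (fun k => \sum_(i <- s) u i k) (\sum_(i <- s) l i).
Proof.
move=> ul; elim: s => [|i s IH].
  by rewrite big_nil; under eq_fun do rewrite big_nil; exact: ccvg_cst.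
by rewrite big_cons; under eq_fun do rewrite big_cons; exact: ccvgD.
Qed.

Lemma ccvg_unique u l (l' : R[i]) : ccvg u l -> ccvg u l' -> l = l'.
Proof.
move=> ul ul'; apply/eqP; rewrite -subr_eq0 -normc_eq0.
suff : (fun=> normc (l - l')) @ \oo --> (0 : R).
  by move/(cvg_unique _ (cvg_cst (normc (l - l')))) => ->.
apply: (squeeze_cvgr _ (cvg_cst 0)
    (_ : (fun k => normc (u k - l) + normc (u k - l')) @ \oo --> (0 : R))).
  near=> k; rewrite normc_ge0/= (normcBC (u k) l).
  apply: le_trans (le_normcD _ _); rewrite le_eqVlt; apply/orP; left.
  by apply/eqP; congr normc; ring.
by rewrite -[X in _ --> X](addr0 (0 : R)); exact: cvgD.
Unshelve. all: by end_near. Qed.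

Lemma ccvg_real (a : nat -> R) (b : R) : a @ \oo --> b -> ccvg (fun k => (a k)%:C) b%:C.
Proof.
move=> ab; rewrite /ccvg; under eq_fun do rewrite -rmorphB normc_real.
have -> : (0 : R) = `|b - b| by rewrite subrr normr0.
by apply: cvg_norm; apply: cvgB => //; exact: cvg_cst.
Qed.

Lemma ccvg_normc_le u l (a : R) : (forall k, normc (u k) <= a) -> ccvg u l -> normc l <= a.
Proof.
move=> ua ul; rewrite leNgt; apply/negP => al.
move/cvgrPdist_lt : ul => /(_ (normc l - a)); rewrite subr_gt0 => /(_ al)[k _ /(_ k (leqnn k))].
rewrite sub0r normrN ger0_norm ?normc_ge0// normcBC => h.
by have := normcB_ge l (u k); have := ua k; lra.
Qed.

(* Unrolling the inequality [m] times leaves [2 ^- m * B] plus finitely many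
   errors, each of which tends to [0]. *)
Lemma contraction_cvg0 (d err : nat -> nat -> R) (B : R) :
  (forall k l : nat, 0 <= d k l) ->
  (forall l : nat, \forall k \near \oo, d k l <= B) ->
  (forall l : nat, \forall k \near \oo, d k l <= 2^-1 * d k l.+1 + err k l) ->
  (forall l : nat, err ^~ l @ \oo --> (0 : R)) ->
  d ^~ 0%N @ \oo --> (0 : R).
Proof.
move=> d0 dB dd err0.
have main m : forall (l : nat) (eta : R), 0 < eta ->
    \forall k \near \oo, d k l <= 2^-1 ^+ m * B + eta.
  elim: m => [|m IH] l eta eta0.
    by apply: filterS (dB l) => k; rewrite expr0 mul1r; lra.
  have eta2 : 0 < eta / 2 by lra.
  have := IH l.+1 _ eta2; have := dd l.
  have /cvgrPdist_lt/(_ _ eta2) := err0 l.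
  apply: filterS3 => k; rewrite sub0r normrN => e1 e2 e3.
  have := ler_norm (err k l); rewrite exprS; lra.
apply/cvgrPdist_le => eta eta0.
have eta2 : 0 < eta / 2 by lra.
have : (fun m : nat => 2^-1 ^+ m * `|B|) @ \oo --> (0 : R).
  rewrite -[X in _ --> X](mul0r `|B|); apply: cvgM; last exact: cvg_cst.
  by apply: cvg_expr; rewrite ger0_norm; lra.
move=> /cvgrPdist_lt /(_ _ eta2)[m _ /(_ m (leqnn m))].
rewrite sub0r normrN => hm.
apply: filterS (main m 0%N _ eta2) => k hk.
rewrite sub0r normrN ger0_norm//.
have : 2^-1 ^+ m * B <= 2^-1 ^+ m * `|B|.
  by rewrite ler_wpM2l ?ler_norm// exprn_ge0.
have := ler_norm (2^-1 ^+ m * `|B|); lra.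
Qed.

End ComplexLimits.

(** * Growth of the recurrences at a point far from the origin *)

Section Growth.
Context {R : realType} {r : nat}.
Variables (M : nat) (x t : R[i]) (e beta : 'I_r -> R[i]).
Variables (P : nat -> R[i]) (S : 'I_r -> nat -> R[i]) (eps Bd delta : R).
Hypotheses (eps_gt0 : 0 < eps) (delta_gt0 : 0 < delta) (delta_le : 2 * delta <= eps).
Hypothesis e_ge : forall j, eps <= normc (e j).
Hypothesis beta_le : \sum_j normc (t * beta j) <= Bd.
Hypothesis t_le : forall m, (m <= M)%N -> normc (t * m%:R) <= 1.
Hypothesis x_ge : delta^-1 + 2 * Bd / eps <= normc x.
Hypothesis P0 : P 0 != 0.
Hypothesis node0 : forall j, P 0 = e j * S j 0.
Hypothesis node : forall j m, (m < M)%N ->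
  P m.+1 = e j * S j m.+1 - (t * m.+1%:R) * S j m.
Hypothesis step : forall m, (m < M)%N ->
  P m.+1 = x * P m - t * \sum_j beta j * S j m.

Lemma growth_sum m : (forall j, normc (S j m) <= 2 / eps * normc (P m)) ->
  normc (t * \sum_j beta j * S j m) <= 2 * Bd / eps * normc (P m).
Proof.
move=> Sm; rewrite mulr_sumr; apply: le_trans (normc_sum _ _ _ _) _.
have -> : 2 * Bd / eps * normc (P m) = Bd * (2 / eps * normc (P m)) by ring.
apply: (@le_trans _ _ ((\sum_j normc (t * beta j)) * (2 / eps * normc (P m)))).
  by rewrite mulr_suml; apply: ler_sum => j _; rewrite mulrA normcM ler_wpM2l ?normc_ge0.
by rewrite ler_wpM2r// !mulr_ge0 ?invr_ge0 ?normc_ge0// ltW.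
Qed.

Lemma growth_low m : (m < M)%N ->
  (forall j, normc (S j m) <= 2 / eps * normc (P m)) ->
  normc (P m) <= delta * normc (P m.+1).
Proof.
move=> mM Sm; rewrite -ler_pdivrMl// step//.
have := normcB_ge (x * P m) (t * \sum_j beta j * S j m).
have := growth_sum _ Sm; rewrite (normcM x (P m)).
have : (delta^-1 + 2 * Bd / eps) * normc (P m) <= normc x * normc (P m).
  by rewrite ler_wpM2r// normc_ge0.
rewrite mulrDl; lra.
Qed.

(** The two claims sustain each other. The bound on S_m makes the sum in [step] at most (2 Bd / eps)
    |P_m|, so the size of x leaves |P_{m+1}| >= |P_m| / delta. Since 2 delta <= eps, the term t (m +
    1) S_m of [node] is then at most |P_{m+1}|, whence |e_j S_{m+1}| <= 2 |P_{m+1}|, which restores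
    the constant 2 / eps. *)
Lemma growth_bounds m : (m <= M)%N ->
  P m != 0 /\ forall j, normc (S j m) <= 2 / eps * normc (P m).
Proof.
elim: m => [|m IH] mM.
  split=> // j; rewrite (node0 j) normcM mulrA.
  rewrite ler_peMl ?normc_ge0// mulrAC ler_pdivlMr// mul1r.
  by have := e_ge j; have := normc_ge0 (e j); lra.
have [Pm Sm] := IH (ltnW mM).
have Pm0 : 0 < normc (P m) by rewrite normc_gt0.
have lowP := growth_low _ mM Sm.
have PS : 0 < normc (P m.+1) by rewrite -(pmulr_rgt0 _ delta_gt0); lra.
split=> [|j]; first by rewrite -normc_gt0.
have : normc (e j * S j m.+1) <= 2 * normc (P m.+1).
  have -> : e j * S j m.+1 = P m.+1 + (t * m.+1%:R) * S j m.
    by rewrite (node j)//; ring.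
  apply: le_trans (le_normcD _ _) _; rewrite normcM.
  have tS : normc (t * m.+1%:R) * normc (S j m) <= 1 * (2 / eps * normc (P m)).
    by apply: ler_pM; rewrite ?normc_ge0 ?t_le.
  have : 2 / eps * normc (P m) <= 2 / eps * (delta * normc (P m.+1)).
    by rewrite ler_pM2l// divr_gt0.
  have : 2 / eps * (delta * normc (P m.+1)) <= normc (P m.+1).
    rewrite mulrA; apply: ler_piMl; first exact: ltW.
    by rewrite mulrAC ler_pdivrMr// mul1r.
  lra.
rewrite normcM mulrAC ler_pdivlMr// [_ * eps]mulrC; apply: le_trans.
by rewrite ler_wpM2r ?normc_ge0.
Qed.

Lemma growth_lower m : (m < M)%N -> normc (P m) <= delta * normc (P m.+1).
Proof.
by move=> mM; have [Pm Sm] := growth_bounds _ (ltnW mM); exact: growth_low.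
Qed.

(** Controls the inverse of the ratio P_m / P_{m+1}, a factor of the bound in [ratio_slow]. *)
Lemma growth_upper m : (m < M)%N ->
  normc (P m.+1) <= (normc x + 2 * Bd / eps) * normc (P m).
Proof.
move=> mM; have [Pm Sm] := growth_bounds _ (ltnW mM).
rewrite step// mulrDl -normcM; apply: le_trans (le_normcD _ _) _.
by rewrite normcN lerD2l; exact: growth_sum.
Qed.

End Growth.

(** * Ratios of consecutive Appell polynomials *)

(** The second identity is (p' / p)' = p'' / p - (p' / p)^2; both are carried along while adding one
    root at a time. *)
Lemma prod_XsubC_derivs {F : fieldType} (zs : seq F) (x : F) :
  let p := \prod_(z <- zs) ('X - z%:P) in
  p.[x] != 0 ->
  p^`().[x] / p.[x] = \sum_(z <- zs) (x - z)^-1 /\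
  p^`()^`().[x] / p.[x] =
    (\sum_(z <- zs) (x - z)^-1) ^+ 2 - \sum_(z <- zs) (x - z)^-2.
Proof.
elim: zs => [|a zs IH] /=.
  rewrite !big_nil => _; rewrite -polyC1 derivC linear0 horner0 !mul0r expr0n/=.
  by rewrite subr0.
rewrite !big_cons hornerM hornerXsubC mulf_eq0 negb_or => /andP[xa q0].
have [] := IH q0; set q := \prod_(z <- zs) _.
set s1 := \sum_(z <- zs) (x - z)^-1; set s2 := \sum_(z <- zs) (x - z)^-2.
move=> h1 h2; have e1 : q^`().[x] = s1 * q.[x] by rewrite -h1 divfK.
have e2 : q^`()^`().[x] = (s1 ^+ 2 - s2) * q.[x] by rewrite -h2 divfK.
rewrite derivM derivXsubC mul1r derivD derivM derivXsubC mul1r.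
rewrite !(hornerD, hornerM, hornerN, hornerX, hornerC) e1 e2.
by split; field; rewrite xa q0.
Qed.

Section System.
Context {R : realType} {r : nat}.
Implicit Types (M : nat) (t x : R[i]) (e beta : 'I_r -> R[i]) (g : {poly R[i]})
  (b : 'I_r -> {poly R[i]}) (eps Bd : R).

(** [eps] and [Bd] are kept as parameters so that one choice can serve a whole sequence of systems,
    which makes [root_radius] a uniform bound. *)
Definition logderiv_system M t e beta g b eps Bd : Prop :=
  [/\ g`_0 != 0,
      forall j, eqmodX M.+1 (('X + (e j)%:P) * b j) g,
      eqmodX M g^`() (\sum_j beta j *: b j),
      forall j, eps <= normc (e j) &
      \sum_j normc (t * beta j) <= Bd] /\
  forall m, (m <= M)%N -> normc (t * m%:R) <= 1.

(** The threshold of the growth estimates for delta = eps / 2, the largest value with 2 delta <=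
    eps. *)
Definition root_radius eps Bd := (eps / 2)^-1 + 2 * Bd / eps.

Section OneSystem.
Variables (M : nat) (t : R[i]) (e beta : 'I_r -> R[i]) (g : {poly R[i]})
  (b : 'I_r -> {poly R[i]}) (eps Bd : R).
Hypothesis eps_gt0 : 0 < eps.
Hypothesis sys : logderiv_system M t e beta g b eps Bd.
Let P x m := (appell t g m).[x].
Let S x j m := (appell t (b j) m).[x].

Let half_gt0 : 0 < eps / 2. Proof. by rewrite divr_gt0. Qed.
Let half_le : 2 * (eps / 2) <= eps. Proof. by rewrite mulrC divfK. Qed.

Lemma value_node0 x j : P x 0 = e j * S x j 0.
Proof. by case: sys => -[_ h _ _ _] _; rewrite /P (appell_node0 t M e g b h j) hornerZ. Qed.

Lemma value_node x j m : (m < M)%N ->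
  P x m.+1 = e j * S x j m.+1 - (t * m.+1%:R) * S x j m.
Proof.
case: sys => -[_ h _ _ _] _ mM.
by rewrite /P (appell_node t M e g b h j m mM) hornerD hornerN !hornerZ.
Qed.

Lemma value_step x m : (m < M)%N ->
  P x m.+1 = x * P x m - t * \sum_j beta j * S x j m.
Proof.
case: sys => -[_ _ h _ _] _ mM.
rewrite /P (appell_step t M beta g b h m mM) hornerD hornerN hornerM hornerX hornerZ.
congr (_ - _ * _); rewrite (_ : (\sum_j _).[x] = \sum_j beta j * S x j m)//.
by rewrite horner_sum; apply: eq_bigr => j _; rewrite hornerZ.
Qed.

Lemma value0 x : P x 0 != 0.
Proof. by rewrite /P appell0 hornerC; case: sys => -[]. Qed.

Lemma value_bounds x m : root_radius eps Bd <= normc x -> (m <= M)%N ->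
  P x m != 0 /\ forall j, normc (S x j m) <= 2 / eps * normc (P x m).
Proof.
case: sys => -[_ _ _ e_ge beta_le] t_le xK mM.
exact: (growth_bounds M x t e beta (P x) (S x) eps Bd (eps / 2) eps_gt0 half_gt0 half_le
  e_ge beta_le t_le xK (value0 x) (value_node0 x) (value_node x) (value_step x)).
Qed.

Lemma ratio_le x m : root_radius eps Bd <= normc x -> (m < M)%N ->
  normc (P x m / P x m.+1) <= eps / 2.
Proof.
move=> xK mM; have [Pm _] := value_bounds _ _ xK mM.
rewrite normcM normcV ler_pdivrMr ?normc_gt0//.
case: sys => -[_ _ _ e_ge beta_le] t_le.
exact: (growth_lower M x t e beta (P x) (S x) eps Bd (eps / 2) eps_gt0 half_gt0 half_le
  e_ge beta_le t_le xK (value0 x) (value_node0 x) (value_node x) (value_step x)).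
Qed.

Lemma ratioV_le x m : root_radius eps Bd <= normc x -> (m < M)%N ->
  normc (P x m.+1 / P x m) <= normc x + 2 * Bd / eps.
Proof.
move=> xK mM; have [Pm _] := value_bounds _ _ xK (ltnW mM).
rewrite normcM normcV ler_pdivrMr ?normc_gt0//.
case: sys => -[_ _ _ e_ge beta_le] t_le.
exact: (growth_upper M x t e beta (P x) (S x) eps Bd (eps / 2) eps_gt0 half_gt0 half_le
  e_ge beta_le t_le xK (value0 x) (value_node0 x) (value_node x) (value_step x)).
Qed.

Lemma appell_root_lt z m : (m <= M)%N -> root (appell t g m) z ->
  normc z < root_radius eps Bd.
Proof.
move=> mM rz; rewrite ltNge; apply/negP => zK.
by have [] := value_bounds _ _ zK mM; rewrite /P (rootP rz) eqxx.
Qed.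

Lemma appell_factor m : exists2 zs : seq R[i],
  size zs = m & appell t g m = g`_0 *: \prod_(z <- zs) ('X - z%:P).
Proof.
have g0 : g`_0 != 0 by case: sys => -[].
have [zs h] := closed_field_poly_normal (appell t g m); exists zs.
  have : size (lead_coef (appell t g m) *: \prod_(z <- zs) ('X - z%:P)) = m.+1.
    by rewrite -h size_appell.
  rewrite size_scale ?size_prod_XsubC => [[]//|].
  by rewrite lead_coef_eq0 -size_poly_eq0 size_appell.
rewrite [LHS]h; congr (_ *: _); rewrite lead_coefE size_appell//=.
by have := coef_appell t g m 0 isT; rewrite subn0 ffactn0 expr0 !mulr1.
Qed.

(** By the Appell property the left-hand side is the logarithmic derivative of the polynomial of
    index m + 1. *)
Lemma ratio_sum_roots x m zs : root_radius eps Bd <= normc x -> (m < M)%N ->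
  appell t g m.+1 = g`_0 *: \prod_(z <- zs) ('X - z%:P) ->
  m.+1%:R * (P x m / P x m.+1) = \sum_(z <- zs) (x - z)^-1.
Proof.
move=> xK mM h; have [] := value_bounds _ _ xK mM; rewrite /P h hornerZ.
rewrite mulf_eq0 negb_or => /andP[g0 p0] _.
have [<- _] := prod_XsubC_derivs zs x p0.
rewrite mulrA -hornerZ -deriv_appell h derivZ hornerZ.
by field; rewrite g0 p0.
Qed.

Lemma ratio2_sum_roots x m zs : root_radius eps Bd <= normc x -> (m.+1 < M)%N ->
  appell t g m.+2 = g`_0 *: \prod_(z <- zs) ('X - z%:P) ->
  m.+2%:R * m.+1%:R * (P x m / P x m.+2) =
    (\sum_(z <- zs) (x - z)^-1) ^+ 2 - \sum_(z <- zs) (x - z)^-2.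
Proof.
move=> xK mM h; have [] := value_bounds _ _ xK mM; rewrite /P h hornerZ.
rewrite mulf_eq0 negb_or => /andP[g0 p0] _.
have [_ <-] := prod_XsubC_derivs zs x p0.
rewrite -[m.+2%:R * _ * _]mulrA [m.+1%:R * _]mulrA -hornerZ -deriv_appell mulrA -hornerZ -derivZ.
rewrite -deriv_appell h !derivZ hornerZ.
by field; rewrite g0 p0.
Qed.

(* [p''/p = (p'/p)^2 - \sum (x - z)^-2], and the last sum has only [m + 2]
   bounded terms, against [(m + 2) * (m + 1)] for the left-hand side. *)
Lemma ratio_slow x m : root_radius eps Bd + 1 <= normc x -> (m.+1 < M)%N ->
  normc (P x m / P x m.+1 - P x m.+1 / P x m.+2) <=
    (1 + (eps / 2) ^+ 2) * (normc x + 2 * Bd / eps) / m.+1%:R.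
Proof.
move=> xK1 mM; have xK : root_radius eps Bd <= normc x by lra.
have [zs szs h] := appell_factor m.+2.
have := ratio2_sum_roots x m zs xK mM h; rewrite -(ratio_sum_roots x m.+1 zs xK mM h).
set s2 := \sum_(z <- zs) _.
have s2le : normc s2 <= m.+2%:R.
  apply: le_trans (normc_sum _ _ _ _) _; rewrite -szs -sum1_size natr_sum.
  rewrite big_seq [leRHS]big_seq; apply: ler_sum => z zzs.
  (* The extra 1 in the assumption on x keeps it at distance at least 1 from every root. *)
  have xz : 1 <= normc (x - z).
    have rz : root (appell t g m.+2) z by rewrite h rootZ ?root_prod_XsubC//; case: sys => -[].
    by have := appell_root_lt _ _ mM rz; have := normcB_ge x z; lra.
  have xz2 : 1 <= normc ((x - z) ^+ 2) by rewrite expr2 normcM mulr_ege1.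
  by rewrite normcV invf_le1// (lt_le_trans ltr01 xz2).
have [P2 _] := value_bounds _ _ xK mM.
have [P1 _] := value_bounds _ _ xK (ltnW mM).
move=> E; set rho := P x m.+1 / P x m.+2 in E *; set rho' := P x m / P x m.+1.
have rho0 : rho != 0 by rewrite mulf_neq0 ?invr_eq0.
(* Dividing (m + 2) (m + 1) rho' rho = ((m + 2) rho)^2 - s2 by (m + 2) rho gives a main term (m + 2)
   rho, which exceeds (m + 1) rho by rho alone; what remains is bounded independently of m. *)
have key : m.+1%:R * (rho' - rho) = (m.+2%:R * rho ^+ 2 - s2) / m.+2%:R * rho^-1.
  have n2 : m.+2%:R != 0 :> R[i] by rewrite pnatr_eq0.
  have E' : m.+2%:R * m.+1%:R * (rho' * rho) = (m.+2%:R * rho) ^+ 2 - s2.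
    by rewrite -E /rho /rho'; field; rewrite P1 P2.
  have m21 : m.+2%:R = m.+1%:R + 1 :> R[i] by rewrite natr1.
  apply: (mulfI rho0); apply: (mulfI n2).
  transitivity ((m.+2%:R * m.+1%:R * (rho' * rho)) - m.+2%:R * m.+1%:R * rho ^+ 2); first by ring.
  rewrite E' m21 in n2 *; field; rewrite rho0.
  by rewrite [1 + m%:R]addrC !natr1 pnatr_eq0.
have n1 : 0 < m.+1%:R :> R by rewrite ltr0n.
rewrite ler_pdivlMr// mulrC -normc_nat -normcM key normcM.
apply: ler_pM; rewrite ?normc_ge0//; last by rewrite /rho invf_div; exact: ratioV_le.
rewrite normcM normcV normc_nat ler_pdivrMr ?ltr0n//.
apply: le_trans (le_normcD _ _) _; rewrite normcN.
have : normc (m.+2%:R * rho ^+ 2) <= m.+2%:R * (eps / 2) ^+ 2.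
  rewrite normcM normc_nat ler_wpM2l//.
  rewrite expr2 normcM -expr2 lerXn2r ?nnegrE ?normc_ge0 ?(ltW half_gt0)//.
  exact: ratio_le.
lra.
Qed.

End OneSystem.

Lemma near_nat_ge (M : nat -> nat) l : M @ \oo --> \oo -> \forall k \near \oo, (l <= M k)%N.
Proof. by move=> Moo; exact: (Moo _ (nbhs_infty_ge l)). Qed.

Lemma cst_div_nat_cvg0 (M : nat -> nat) (C : R) :
  M @ \oo --> \oo -> (fun k => C / (M k)%:R) @ \oo --> (0 : R).
Proof.
move=> Moo; rewrite -(mulr0 C); apply: cvgM; first exact: cvg_cst.
apply/cvgrPdist_lt => eta eta0.
apply: filterS (near_nat_ge _ (Num.truncn eta^-1).+1 Moo) => k hk.
have Mk : eta^-1 < (M k)%:R.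
  by apply: lt_le_trans (truncnS_gt _) _; rewrite ler_nat.
rewrite sub0r normrN ger0_norm ?invr_ge0//.
have M0 : 0 < (M k)%:R :> R by apply: lt_trans Mk; rewrite invr_gt0.
by rewrite invf_plt ?posrE.
Qed.

(** * Passage to the limit at a fixed point x *)

Section Limit.
Variables (M : nat -> nat) (t : nat -> R[i]) (e beta : nat -> 'I_r -> R[i])
  (g : nat -> {poly R[i]}) (b : nat -> 'I_r -> {poly R[i]}) (eps Bd : R)
  (e_lim blim : 'I_r -> R[i]) (x y : R[i]).
Hypothesis eps_gt0 : 0 < eps.
Hypothesis sys : forall k, logderiv_system (M k) (t k) (e k) (beta k) (g k) (b k) eps Bd.
Hypothesis M_cvg : M @ \oo --> \oo.
Hypothesis t_cvg : ccvg t 0.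
Hypothesis tM_cvg : ccvg (fun k => t k * (M k)%:R) 1.
Hypothesis e_cvg : forall j, ccvg (e ^~ j) (e_lim j).
Hypothesis beta_cvg : forall j, ccvg (fun k => t k * beta k j) (blim j).
Hypothesis x_ge : root_radius eps Bd + 1 <= normc x.
Let P k m := (appell (t k) (g k) m).[x].
Let S k j m := (appell (t k) (b k j) m).[x].
Hypothesis y_cvg : ccvg (fun k => P k (M k).-1 / P k (M k)) y.

(** Indices are counted down from [M k]: for fixed [l] they stay at bounded distance from the top
    and still tend to infinity with k, so the truncated subtractions are exact for large k. *)
Let rho k l := P k (M k - l.+1)%N / P k (M k - l)%N.
Let s k l j := S k j (M k - l.+1)%N / P k (M k - l.+1)%N.

Let x_ge' : root_radius eps Bd <= normc x.
Proof. by have := x_ge; lra. Qed.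

Lemma subM_cvg l : (fun k => (M k - l)%N) @ \oo --> \oo.
Proof.
move=> A [n _ nA]; apply: filterS (near_nat_ge _ (n + l)%N M_cvg) => k hk.
by apply: nA; rewrite /= leq_subRL ?(leq_trans (leq_addl _ _) hk)// addnC.
Qed.

(** [ratio_slow] carries the limit down one index at a time. *)
Lemma rho_cvg l : ccvg (rho ^~ l) y.
Proof.
elim: l => [|l IH].
  by rewrite /rho; under eq_fun do rewrite subn1 subn0.
set C := (1 + (eps / 2) ^+ 2) * (normc x + 2 * Bd / eps).
apply: (@ccvg_le _ _ _ (fun k => normc (rho k l - y) + C / (M k - l.+1)%:R)).
  apply: filterS (near_nat_ge _ l.+2 M_cvg) => k hk.
  have E : (M k - l.+1)%N = (M k - l.+2).+1 by rewrite subnSK.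
  have E' : (M k - l)%N = (M k - l.+2).+2 by rewrite -E subnSK// ltnW.
  have := ratio_slow _ _ _ _ _ _ _ _ eps_gt0 (sys k) x (M k - l.+2)%N x_ge.
  have lt2 : ((M k - l.+2).+1 < M k)%N by rewrite -E' leq_subr.
  move/(_ lt2); rewrite -/C /rho E E' => h.
  rewrite [leRHS]addrC; apply: le_trans (lerD h (lexx _)).
  apply: le_trans (le_normcD _ _); rewrite le_eqVlt; apply/orP; left.
  by apply/eqP; congr normc; rewrite /P; ring.
rewrite -[X in _ --> X](addr0 (0 : R)); apply: cvgD => //.
exact/cst_div_nat_cvg0/subM_cvg.
Qed.

Lemma y_le : normc y <= eps / 2.
Proof.
(* [ccvg_normc_le] asks for a bound at every k, but for [M k] = 0 the truncated index makes
   [rho k 0] equal to 1. *)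
pose u k := if (0 < M k)%N then rho k 0 else 0.
apply: (@ccvg_normc_le _ u) => [k|].
  rewrite /u; case: ifPn => M0; last by rewrite normc0 divr_ge0// ltW.
  rewrite /rho subn1 subn0 -{2}(prednK M0).
  by apply: (ratio_le _ _ _ _ _ _ _ _ eps_gt0 (sys k)); rewrite ?prednK.
apply: (@ccvg_le _ _ _ (fun k => normc (rho k 0 - y))); last exact: rho_cvg.
by apply: filterS (near_nat_ge _ 1 M_cvg) => k M0; rewrite /u M0.
Qed.

Lemma e_lim_ge j : eps <= normc (e_lim j).
Proof.
rewrite leNgt; apply/negP => lt.
have /cvgrPdist_lt/(_ (eps - normc (e_lim j))) := e_cvg j.
rewrite subr_gt0 => /(_ lt)[k _ /(_ k (leqnn k))].
rewrite sub0r normrN ger0_norm ?normc_ge0// => h.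
have [[_ _ _ /(_ j) h2 _] _] := sys k.
by have := normcB_ge (e k j) (e_lim j); lra.
Qed.

(** |y| <= eps / 2 < eps <= |e_lim j|. This also provides the nonvanishing denominators of the final
    equation. *)
Lemma e_lim_sub_neq0 j : e_lim j - y != 0.
Proof.
rewrite -normc_gt0; apply: lt_le_trans (normcB_ge _ _); rewrite subr_gt0.
apply: le_lt_trans y_le (lt_le_trans _ (e_lim_ge j)).
by rewrite ltr_pdivrMr// ltr_pMr// ltr1n.
Qed.

Lemma s_step k l j : (l.+2 <= M k)%N ->
  e k j * s k l j = 1 + (t k * (M k - l.+1)%:R) * rho k l.+1 * s k l.+1 j.
Proof.
move=> hk; have E : (M k - l.+1)%N = (M k - l.+2).+1 by rewrite subnSK.
have ltM : (M k - l.+2 < M k)%N by rewrite -E leq_subr.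
have [P1 _] := value_bounds _ _ _ _ _ _ _ _ eps_gt0 (sys k) x _ x_ge' ltM.
have [P0 _] := value_bounds _ _ _ _ _ _ _ _ eps_gt0 (sys k) x _ x_ge' (ltnW ltM).
rewrite /s /rho E; move: P0 P1 (value_node _ _ _ _ _ _ _ _ (sys k) x j _ ltM).
rewrite -/(P _ _) -/(P _ _) -/(S _ _ _) -/(S _ _ _) => P0 P1 h.
rewrite mulrA (_ : e k j * S k j (M k - l.+2).+1 =
  P k (M k - l.+2).+1 + (t k * (M k - l.+2).+1%:R) * S k j (M k - l.+2)%N); last first.
  by rewrite h; ring.
by field; rewrite P0 P1.
Qed.

(** [sl] solves e s = 1 + y s. Subtracting this from [s_step] bounds the error at l by (eps / 2) /
    eps = 1/2 times the error at l + 1, plus a term that tends to 0 for each l, as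
    [contraction_cvg0] requires. *)
Lemma s_cvg j : ccvg (fun k => s k 0 j) (e_lim j - y)^-1.
Proof.
set sl := (e_lim j - y)^-1.
pose tau k l := t k * (M k - l.+1)%:R.
have tau_cvg l : ccvg (tau ^~ l) 1.
  apply: (@ccvg_le _ _ _ (fun k => normc (t k * (M k)%:R + (- l.+1%:R) * t k - 1))).
    apply: filterS (near_nat_ge _ l.+1 M_cvg) => k hk.
    by rewrite /tau natrB// le_eqVlt; apply/orP; left; apply/eqP; congr normc; ring.
  suff : ccvg (fun k => t k * (M k)%:R + (- l.+1%:R) * t k) (1 + (- l.+1%:R) * 0).
    by rewrite mulr0 addr0.
  by apply: ccvgD => //; apply: ccvgM => //; exact: ccvg_cst.
pose err k l := (normc (tau k l * rho k l.+1 - y) + normc (e k j - e_lim j))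
   * (normc sl / eps).
apply: (contraction_cvg0 (fun k l => normc (s k l j - sl)) err (2 / eps + normc sl)).
- by move=> k l; exact: normc_ge0.
- move=> l; apply: filterS (near_nat_ge _ l.+1 M_cvg) => k hk.
  apply: le_trans (le_normcD _ _) _; rewrite normcN lerD2r /s normcM normcV.
  have [P0 hS] := value_bounds _ _ _ _ _ _ _ _ eps_gt0 (sys k) x _ x_ge' (leq_subr l.+1 (M k)).
  by rewrite ler_pdivrMr ?normc_gt0 //; exact: hS.
- move=> l; apply: filterS (near_nat_ge _ l.+2 M_cvg) => k hk.
  have [[_ _ _ /(_ j) ek _] tk] := sys k.
  have taule : normc (tau k l * rho k l.+1) <= eps / 2.
    rewrite normcM -[leRHS]mul1r; apply: ler_pM; rewrite ?normc_ge0 ?tk ?leq_subr//.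
    rewrite /rho -[(M k - l.+1)%N](@subnSK) //.
    apply: (ratio_le _ _ _ _ _ _ _ _ eps_gt0 (sys k)) => //.
    by rewrite subnSK// leq_subr.
  have key : e k j * (s k l j - sl) = tau k l * rho k l.+1 * (s k l.+1 j - sl)
      + (tau k l * rho k l.+1 - y) * sl - (e k j - e_lim j) * sl.
    have -> : e k j * (s k l j - sl) = e k j * s k l j - e k j * sl by ring.
    rewrite s_step// -/(tau k l) /sl; field; exact: e_lim_sub_neq0.
  have : eps * normc (s k l j - sl) <= normc (e k j * (s k l j - sl)).
    by rewrite normcM ler_wpM2r ?normc_ge0.
  rewrite {}key => h.
  have h2 : normc (tau k l * rho k l.+1 * (s k l.+1 j - sl)
      + (tau k l * rho k l.+1 - y) * sl - (e k j - e_lim j) * sl) <=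
     eps / 2 * normc (s k l.+1 j - sl) + normc (tau k l * rho k l.+1 - y) * normc sl
     + normc (e k j - e_lim j) * normc sl.
    apply: le_trans (le_normcD _ _) _; rewrite normcN (normcM (e k j - e_lim j)) lerD2r.
    apply: le_trans (le_normcD _ _) _; rewrite (normcM (_ - y)) lerD2r.
    by rewrite normcM ler_wpM2r ?normc_ge0.
  have h3 := le_trans h h2.
  rewrite -(ler_pM2l eps_gt0); apply: le_trans h3 _.
  rewrite /err le_eqVlt; apply/orP; left; apply/eqP; field.
  by rewrite gt_eqF.
- move=> l; rewrite /err -[X in _ --> X](mul0r (normc sl / eps)).
  apply: cvgM; last exact: cvg_cst.
  rewrite -[X in _ --> X](addr0 (0 : R)); apply: cvgD; last exact: e_cvg.
  have : ccvg (fun k => tau k l * rho k l.+1) (1 * y).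
    by apply: ccvgM => //; exact: rho_cvg.
  by rewrite mul1r.
Qed.

(** The step from M - 1 to M, divided by P_M, has both sides convergent. *)
Theorem logderiv_system_limit :
  x * y = 1 + y * \sum_j blim j / (e_lim j - y).
Proof.
apply: (@ccvg_unique _ (fun k => x * rho k 0)).
  by apply: ccvgM; [exact: ccvg_cst|exact: rho_cvg].
apply: (@ccvg_le _ _ _ (fun k => normc (1 + rho k 0 * (\sum_j (t k * beta k j) * s k 0 j)
   - (1 + y * \sum_j blim j / (e_lim j - y))))).
  apply: filterS (near_nat_ge _ 1 M_cvg) => k M0.
  rewrite le_eqVlt; apply/orP; left; apply/eqP; congr (normc (_ - _)).
  have ltM : ((M k).-1 < M k)%N by rewrite prednK.
  have [P1 _] := value_bounds _ _ _ _ _ _ _ _ eps_gt0 (sys k) x _ x_ge' (leqnn (M k)).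
  have [P0 _] := value_bounds _ _ _ _ _ _ _ _ eps_gt0 (sys k) x _ x_ge' (ltnW ltM).
  have := value_step _ _ _ _ _ _ _ _ (sys k) x _ ltM.
  rewrite prednK// -/(P _ _) -/(P _ _) => h.
  rewrite /rho /s subn1 subn0.
  have -> : \sum_j t k * beta k j * (S k j (M k).-1 / P k (M k).-1) =
     (t k * \sum_j beta k j * S k j (M k).-1) / P k (M k).-1.
    by rewrite mulr_sumr mulr_suml; apply: eq_bigr => j _; ring.
  have -> : t k * \sum_j beta k j * S k j (M k).-1 = x * P k (M k).-1 - P k (M k).
    by rewrite h; ring.
  by field; rewrite P0 P1.
apply: ccvgD; first exact: ccvg_cst.
apply: ccvgM; first exact: rho_cvg.
by apply: ccvg_sum => j; apply: ccvgM => //; exact: s_cvg.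
Qed.

End Limit.
End System.

(** * Moments of the weights *)

Section GammaWeight.
Context {R : realType}.
Notation mu := (@lebesgue_measure R).
Implicit Types (s c x : R).

Lemma pos_FTC2 (F f : R -> R) (a b : R) : 0 < a -> a < b ->
  (forall x, 0 < x -> is_derive x 1 F (f x)) ->
  (forall x, 0 < x -> {for x, continuous f}) ->
  (\int[mu]_(x in `[a, b]) (f x)%:E = (F b)%:E - (F a)%:E)%E.
Proof.
move=> a0 ab dF cf.
have cF x : 0 < x -> {for x, continuous F}.
  move=> x0; apply: differentiable_continuous; apply/derivable1_diffP.
  by have [] := dF x x0.
apply: continuous_FTC2 => //.
- apply: continuous_in_subspaceT => x; rewrite inE/= in_itv/= => /andP[ax _].
  by apply: cf; exact: lt_le_trans ax.
- split.
  + by move=> x; rewrite in_itv/= => /andP[ax _]; have [] := dF x (lt_trans a0 ax).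
  + by apply: cvg_at_right_filter; exact: cF.
  + by apply: cvg_at_left_filter; apply: cF; exact: lt_trans ab.
- move=> x; rewrite in_itv/= => /andP[ax _]; rewrite derive1E.
  by have [_ ->] := dF x (lt_trans a0 ax).
Qed.

Definition gweight s c x := x `^ s * expR (- c * x).

Lemma is_derive_expR_lin c x : is_derive x 1 (fun y => expR (- c * y)) (- c * expR (- c * x)).
Proof.
have h1 : is_derive x 1 (- c \*: @id R) (- c *: (1 : R)) by exact: is_deriveZ.
have h2 := is_derive_expR (- c * x).
have E : expR (- c * x) * (- c *: (1 : R)) = - c * expR (- c * x).
  by rewrite /GRing.scale/= mulr1 mulrC.
by rewrite -E; exact: (is_derive1_comp h2 h1).
Qed.

Lemma is_derive_gweight s c x : 0 < x ->
  is_derive x 1 (gweight (s + 1) c) ((s + 1) * gweight s c x - c * gweight (s + 1) c x).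
Proof.
move=> x0; have h1 := is_derive1_powR (s + 1) x0; have h2 := is_derive_expR_lin c x.
have := is_deriveM h1 h2; rewrite addrK.
have -> : x `^ (s + 1) *: (- c * expR (- c * x)) + expR (- c * x) *: ((s + 1) * x `^ s) =
  (s + 1) * gweight s c x - c * gweight (s + 1) c x.
  by rewrite /gweight /GRing.scale/=; ring.
exact.
Qed.

Lemma is_derive_continuous (f : R -> R) x df : is_derive x 1 f df -> {for x, continuous f}.
Proof. by move=> [h _]; apply: differentiable_continuous; exact/derivable1_diffP. Qed.

Lemma continuous_gweight s c x : 0 < x -> {for x, continuous (gweight s c)}.
Proof.
move=> x0; rewrite -(subrK 1 s).
exact: (is_derive_continuous _ _ _ (is_derive_gweight (s - 1) c x x0)).
Qed.

Lemma gweight_ge0 s c x : 0 <= gweight s c x.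
Proof. by rewrite mulr_ge0 ?powR_ge0 ?expR_ge0. Qed.

Lemma gweightS s c x : 0 < x -> gweight (s + 1) c x = x * gweight s c x.
Proof.
move=> x0; rewrite /gweight powRD ?(gt_eqF x0) ?implybT// powRr1 ?ltW//; ring.
Qed.

(** Raise u <= exp u to the power p, with u = c (x + 1) / p; the factor exp c in the constant
    accounts for x + 1 in place of x. *)
Lemma powR_expR_bound p c : 0 < p -> 0 < c -> exists2 C, 0 < C &
  forall x, 0 < x -> (x + 1) `^ p * expR (- c * x) <= C.
Proof.
move=> p0 c0; exists ((p / c) `^ p * expR c).
  by rewrite mulr_gt0 ?expR_gt0 ?powR_gt0 ?divr_gt0.
move=> x x0; set u := c / p * (x + 1).
have u0 : 0 <= u by rewrite mulr_ge0 ?divr_ge0 ?ltW// addr_gt0.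
have uE : u <= expR u by have := expR_ge1Dx u; lra.
have xE : x + 1 = p / c * u by rewrite /u; field; rewrite !gt_eqF.
have : (x + 1) `^ p <= (p / c) `^ p * expR (c * (x + 1)).
  rewrite {1}xE powRM ?divr_ge0 ?(ltW p0) ?(ltW c0)// ler_wpM2l ?powR_ge0//.
  have -> : c * (x + 1) = u * p by rewrite /u; field; rewrite gt_eqF.
  by rewrite expRM ge0_ler_powR ?nnegrE ?expR_ge0 ?(ltW p0).
move=> /(ler_wpM2r (expR_ge0 (- c * x))) /le_trans; apply.
rewrite -mulrA -expRD le_eqVlt; apply/orP; left; apply/eqP; congr (_ * expR _); ring.
Qed.

(** Compact intervals away from the origin, where the weight may be unbounded; m + 2 instead of m +
    1 keeps the endpoints distinct. *)
Definition exhaust m : set R := `[m.+2%:R^-1, m.+2%:R]%classic.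

Lemma exhaust_bounds m : 0 < m.+2%:R^-1 :> R /\ m.+2%:R^-1 < m.+2%:R :> R.
Proof.
split; first by rewrite invr_gt0.
by apply: (@lt_trans _ _ 1); rewrite ?invf_lt1// ltr1n.
Qed.

Lemma exhaust_nd : nondecreasing_seq exhaust.
Proof.
move=> m m' mm'; apply/subsetPset => x; rewrite /exhaust/= !in_itv/= => /andP[h1 h2].
rewrite (le_trans _ h1) ?(le_trans h2) ?ler_nat ?ltnS//.
by rewrite lef_pV2 ?posrE// ler_nat !ltnS.
Qed.

Lemma exhaust_sub m : exhaust m `<=` `]0%R, +oo[%classic.
Proof.
move=> x; rewrite /exhaust/= !in_itv/= andbT => /andP[h _].
by apply: lt_le_trans h; have [] := exhaust_bounds m.
Qed.

Lemma bigcup_exhaust : \bigcup_m exhaust m = `]0%R, +oo[%classic.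
Proof.
apply/seteqP; split => x; first by move=> [m _ /exhaust_sub].
rewrite /= in_itv/= andbT => x0.
(* The sum dominates both x and 1 / x, which handles the two ends at once. *)
exists (Num.truncn (x + x^-1)) => //=; rewrite /exhaust/= in_itv/=.
have h : x + x^-1 < (Num.truncn (x + x^-1)).+2%:R.
  by apply: lt_trans (truncnS_gt _) _; rewrite ltr_nat.
have x1 : 0 < x^-1 by rewrite invr_gt0.
apply/andP; split; last by lra.
rewrite invf_ple ?posrE//; lra.
Qed.

Lemma pos_measurable (f : R -> R) :
  (forall x, 0 < x -> {for x, continuous f}) -> measurable_fun (`]0%R, +oo[%classic : set R) f.
Proof.
move=> cf; apply: open_continuous_measurable_fun; first exact: interval_open.
by move=> x; rewrite inE/= in_itv/= andbT; exact: cf.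
Qed.

Lemma pos_measurable_exhaust m (f : R -> R) :
  (forall x, 0 < x -> {for x, continuous f}) -> measurable_fun (exhaust m) f.
Proof.
move=> /pos_measurable; apply: measurable_funS; [exact: measurable_itv|exact: exhaust_sub].
Qed.

Lemma exhaust_cvg s c :
  (\int[mu]_(x in exhaust m) (gweight s c x)%:E @[m --> \oo] -->
   \int[mu]_(x in `]0%R, +oo[) (gweight s c x)%:E)%E.
Proof.
rewrite -bigcup_exhaust; apply: ge0_nondecreasing_set_cvg_integral.
- exact: exhaust_nd.
- by move=> m; exact: measurable_itv.
- move=> m; apply/measurable_EFinP; apply: pos_measurable_exhaust => x.
  exact: continuous_gweight.
- by move=> m x _; rewrite lee_fin gweight_ge0.
Qed.

(* [(x / (x + 1)) `^ (s + 1)] is bounded by [1], and its derivative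
   [(s + 1) * x `^ s * (x + 1) `^ - (s + 2)] dominates the weight. *)
Lemma gweight_integral_lty s c : -1 < s -> 0 < c ->
  (\int[mu]_(x in `]0%R, +oo[) (gweight s c x)%:E < +oo)%E.
Proof.
move=> s1 c0; have s0 : 0 < s + 1 by lra.
have s2 : 0 < s + 2 by lra.
have [C C0 hC] := powR_expR_bound (s + 2) c s2 c0.
pose H x := C / (s + 1) * (x `^ (s + 1) * (x + 1) `^ (- (s + 1))).
pose h x := C * (x `^ s * (x + 1) `^ (- (s + 2))).
have shift_derive a x : 0 < x + 1 ->
    is_derive x 1 (fun y => (y + 1) `^ a) (a * (x + 1) `^ (a - 1)).
  move=> x1; have h1 := is_derive1_powR a x1.
  have h2 := is_derive_shift x (1 : R) (1 : R).
  have := is_derive1_comp (h1 : is_derive (shift 1 x) 1 (fun y : R => y `^ a) _) h2.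
  by rewrite mulr1.
have dH x : 0 < x -> is_derive x 1 H (h x).
  move=> x0; have x1 : 0 < x + 1 by lra.
  have h1 := is_derive1_powR (s + 1) x0.
  have h3 := shift_derive (- (s + 1)) x x1.
  have := is_deriveZ (C / (s + 1)) (is_deriveM h1 h3).
  set v := (_ *: _) => h4; suff <- : v = h x by exact: h4.
  rewrite /v /GRing.scale/= addrK /h.
  have -> : - (s + 1) - 1 = - (s + 2) by ring.
  have -> : - (s + 1) = - (s + 2) + 1 by ring.
  rewrite [(x + 1) `^ (- (s + 2) + 1)]powRD ?(gt_eqF x1) ?implybT//.
  rewrite powRr1 ?(ltW x1)// [x `^ (s + 1)]powRD ?(gt_eqF x0) ?implybT// powRr1 ?(ltW x0)//.
  by field; rewrite gt_eqF.
have ch x : 0 < x -> {for x, continuous h}.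
  move=> x0; have x1 : 0 < x + 1 by lra.
  apply: cvgM; first exact: cvg_cst.
  apply: cvgM; first exact: (is_derive_continuous _ _ _ (is_derive1_powR s x0)).
  exact: (is_derive_continuous _ _ _ (shift_derive (- (s + 2)) x x1)).
have bound m : (\int[mu]_(x in exhaust m) (gweight s c x)%:E <= (C / (s + 1))%:E)%E.
  have [a0 ab] := exhaust_bounds m.
  apply: (@le_trans _ _ (\int[mu]_(x in exhaust m) (h x)%:E)%E).
    apply: ge0_le_integral.
    - exact: measurable_itv.
    - by move=> x _; rewrite lee_fin gweight_ge0.
    - apply/measurable_EFinP; apply: pos_measurable_exhaust => x.
      exact: continuous_gweight.
    - by apply/measurable_EFinP; exact: pos_measurable_exhaust.
    - move=> x /exhaust_sub; rewrite /= in_itv/= andbT => x0.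
      have x1 : 0 < x + 1 by lra.
      rewrite lee_fin /gweight /h mulrCA ler_wpM2l ?powR_ge0//.
      by rewrite powRN ler_pdivlMr ?powR_gt0// mulrC; exact: hC.
  rewrite (pos_FTC2 H h _ _ a0 ab dH ch) -EFinB lee_fin.
  have Ha : 0 <= H m.+2%:R^-1 by rewrite !mulr_ge0 ?invr_ge0 ?powR_ge0// ltW.
  suff : H m.+2%:R <= C / (s + 1) by lra.
  rewrite /H ler_piMr ?divr_ge0 ?(ltW C0) ?(ltW s0)//.
  rewrite powRN ler_pdivrMr ?powR_gt0// mul1r.
  by rewrite ge0_ler_powR ?nnegrE ?(ltW s0)// lerDl.
apply: (@le_lt_trans _ _ (C / (s + 1))%:E); last exact: ltry.
rewrite -(cvg_lim _ (exhaust_cvg s c))//; apply: lime_le.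
  by apply/cvg_ex; eexists; exact: exhaust_cvg.
by near=> m; exact: bound.
Unshelve. all: by end_near. Qed.

Lemma gweight_integrable s c : -1 < s -> 0 < c ->
  mu.-integrable `]0%R, +oo[ (EFin \o gweight s c).
Proof.
move=> s1 c0; apply/integrableP; split.
  by apply/measurable_EFinP; apply: pos_measurable => x; exact: continuous_gweight.
under eq_integral => x _ do rewrite /= ger0_norm ?gweight_ge0//.
exact: gweight_integral_lty.
Qed.

(** Equal to Gamma(s + 1) / c^(s + 1) when s > -1 and c > 0; positivity and the recurrence in s
    stand in for the closed form. *)
Definition gammaI s c := \int[mu]_(x in `]0%R, +oo[) gweight s c x.

Lemma gammaI_EFin s c : -1 < s -> 0 < c ->
  (\int[mu]_(x in `]0%R, +oo[) (gweight s c x)%:E)%E = (gammaI s c)%:E.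
Proof.
move=> s1 c0; rewrite /gammaI /Rintegral fineK//.
exact: integrable_fin_num (gweight_integrable s c s1 c0).
Qed.

Let part s c m := \int[mu]_(x in exhaust m) gweight s c x.

Lemma part_cvg s c : -1 < s -> 0 < c -> part s c @ \oo --> gammaI s c.
Proof.
move=> s1 c0; apply: fine_cvg; rewrite -gammaI_EFin//.
exact: exhaust_cvg.
Qed.

(** Boundary terms of an integration by parts. At infinity the weight is at most C / x, by the bound
    on the weight of exponent s + 2; near 0 it is at most x^(s + 1), with s + 1 > 0. *)
Lemma gweight_ends_cvg s c : -1 < s -> 0 < c ->
  (fun m => gweight (s + 1) c m.+2%:R - gweight (s + 1) c m.+2%:R^-1) @ \oo --> (0 : R).
Proof.
move=> s1 c0; rewrite -[X in _ --> X](subr0 (0 : R)); apply: cvgB.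
  have s2 : 0 < s + 2 by lra.
  have [C C0 hC] := powR_expR_bound (s + 2) c s2 c0.
  have lim : (fun m => C * m.+1%:R^-1) @ \oo --> (0 : R).
    by rewrite -(mulr0 C); apply: cvgM; [exact: cvg_cst|exact: cvg_harmonic].
  apply: (squeeze_cvgr _ (cvg_cst 0) lim); near=> m.
  rewrite gweight_ge0/= ler_pdivlMr//.
  have b0 : 0 < m.+2%:R :> R by [].
  apply: le_trans (hC _ b0).
  apply: (@le_trans _ _ (m.+2%:R * gweight (s + 1) c m.+2%:R)).
    by rewrite mulrC ler_wpM2r ?gweight_ge0// ler_nat.
  rewrite -gweightS// (_ : s + 1 + 1 = s + 2); last by ring.
  rewrite /gweight ler_wpM2r ?expR_ge0// ge0_ler_powR ?nnegrE ?(ltW s2)//.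
  by rewrite lerDl.
have lim : (fun m => (m.+2%:R^-1 : R) `^ (s + 1)) @ \oo --> (0 : R).
  have s0 : 0 < s + 1 by lra.
  have /cvg_at_rightP := powR_cvg0 s0; apply; split => [m|]; first by rewrite invr_gt0.
  by have := @cvg_harmonic R; rewrite -(cvg_shiftn 1); under eq_fun do rewrite /= addn1.
apply: (squeeze_cvgr _ (cvg_cst 0) lim); near=> m.
rewrite gweight_ge0/= /gweight ler_piMr ?powR_ge0// expR_le1.
by rewrite mulNr oppr_le0 mulr_ge0 ?invr_ge0// ltW.
Unshelve. all: by end_near. Qed.

(** Integrate the derivative of x^(s + 1) exp(- c x) over the exhausting intervals. *)
Lemma gammaIS s c : -1 < s -> 0 < c -> c * gammaI (s + 1) c = (s + 1) * gammaI s c.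
Proof.
move=> s1 c0; have s1' : -1 < s + 1 by lra.
apply/eqP; rewrite eq_sym -subr_eq0; apply/eqP.
have h1 : (fun m => (s + 1) * part s c m - c * part (s + 1) c m) @ \oo -->
    (s + 1) * gammaI s c - c * gammaI (s + 1) c.
  by apply: cvgB; apply: cvgM; [exact: cvg_cst|exact: part_cvg|exact: cvg_cst|exact: part_cvg].
apply: (cvg_unique _ h1) => //.
suff -> : (fun m => (s + 1) * part s c m - c * part (s + 1) c m) =
  (fun m => gweight (s + 1) c m.+2%:R - gweight (s + 1) c m.+2%:R^-1).
  exact: gweight_ends_cvg.
apply/funext => m; have [a0 ab] := exhaust_bounds m.
have ii p : -1 < p -> mu.-integrable (exhaust m) (EFin \o gweight p c).
  move=> p1; apply: integrableS (gweight_integrable p c p1 c0).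
  - exact: measurable_itv.
  - exact: measurable_itv.
  - exact: exhaust_sub.
have mE : measurable (exhaust m) by exact: measurable_itv.
have iZ p a : -1 < p -> mu.-integrable (exhaust m) (EFin \o (fun x => a * gweight p c x)).
  move=> p1; rewrite (_ : _ \o _ = (fun x => a%:E * (EFin \o gweight p c) x)%E).
    by apply: integrableZl => //; exact: ii.
  by apply/funext => x; rewrite /= EFinM.
rewrite /part -!RintegralZl//; [|exact: ii..].
rewrite -RintegralB//; [|exact: iZ..].
have cont x : 0 < x ->
    {for x, continuous (fun x => (s + 1) * gweight s c x - c * gweight (s + 1) c x)}.
  move=> x0; apply: cvgB; apply: cvgM; [exact: cvg_cst|exact: continuous_gweight|
    exact: cvg_cst|exact: continuous_gweight].
by rewrite /Rintegral (pos_FTC2 _ _ _ _ a0 ab (is_derive_gweight s c) cont).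
Qed.

Lemma gammaI_gt0 s c : -1 < s -> 0 < c -> 0 < gammaI s c.
Proof.
move=> s1 c0; rewrite -lte_fin -gammaI_EFin//.
apply: (@lt_le_trans _ _ (\int[mu]_(x in `[1%R, 2%R]) (2^-1 * expR (- c * 2))%:E)%E).
  rewrite integral_cst/=; last exact: measurable_itv.
  rewrite lebesgue_measure_itv/= lte_fin ltr1n/= -EFinB -EFinM lte_fin.
  by rewrite !mulr_gt0 ?expR_gt0//; lra.
apply: (@le_trans _ _ (\int[mu]_(x in `[1%R, 2%R]) (gweight s c x)%:E)%E).
  have sub : `[1%R, 2%R]%classic `<=` (`]0%R, +oo[%classic : set R).
    by move=> x /=; rewrite !in_itv/= andbT => /andP[h _]; lra.
  apply: ge0_le_integral.
  - exact: measurable_itv.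
  - by move=> x _; rewrite lee_fin mulr_ge0 ?expR_ge0.
  - by apply/measurable_EFinP; exact: measurable_cst.
  - apply/measurable_EFinP; apply: (measurable_funS _ sub); first exact: measurable_itv.
    by apply: pos_measurable => x; exact: continuous_gweight.
  - move=> x /=; rewrite in_itv/= => /andP[x1 x2].
    have x0 : 0 < x by lra.
    rewrite lee_fin /gweight; apply: ler_pM; rewrite ?expR_ge0//; last first.
      by rewrite ler_expR !mulNr lerN2 ler_wpM2l// ltW.
    (* The exponent s may be negative, so x^s >= 1/2 is read off from x^(1 + s) >= 1 >= x / 2 on
       [1, 2]. *)
    rewrite -(ler_pM2l x0) -{2}(powRr1 (ltW x0)) -powRD ?(gt_eqF x0) ?implybT//.
    apply: (@le_trans _ _ 1); first by lra.
    have : (1 : R) `^ (1 + s) <= x `^ (1 + s) by rewrite ge0_ler_powR ?nnegrE//; lra.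
    by rewrite powR1.
apply: ge0_subset_integral.
- exact: measurable_itv.
- exact: measurable_itv.
- by apply/measurable_EFinP; apply: pos_measurable => x; exact: continuous_gweight.
- by move=> x _; rewrite lee_fin gweight_ge0.
- by move=> x /=; rewrite !in_itv/= andbT => /andP[h _]; lra.
Qed.

Lemma gammaI_rising s c m : -1 < s -> 0 < c ->
  gammaI (s + m%:R) c = gammaI s c * rising (s + 1) m / c ^+ m.
Proof.
move=> s1 c0; elim: m => [|m IH]; first by rewrite addr0 /rising big_ord0 expr0 mulr1 divr1.
have sm : -1 < s + m%:R by apply: lt_le_trans s1 _; rewrite lerDl.
rewrite -natr1 addrA; have cn0 : c != 0 by rewrite gt_eqF.
apply: (mulfI cn0).
rewrite gammaIS// IH risingSr exprS; field.
by rewrite expf_neq0 gt_eqF.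
Qed.

Lemma rising_gt0 (a : R) m : 0 < a -> 0 < rising a m.
Proof.
by move=> a0; apply: prodr_gt0 => j _; apply: lt_le_trans a0 _; rewrite lerDl.
Qed.

(** The rising factorial of length m + k splits into one of length k, common to all terms, and one
    of length m starting at alpha + 1 + k. Pulling out the first leaves the normalization of
    [moment_coef]. *)
Lemma typeI_moment (r : nat) (n : 'I_r -> nat) (alpha : R) (c : 'I_r -> R)
    (L : 'I_r -> {poly R}) k :
  -1 < alpha -> (forall j, 0 < c j) -> (forall j, (size (L j) <= n j)%N) ->
  (\int[mu]_(x in `]0%R, +oo[)
     ((\sum_j (L j).[x] * (x `^ alpha * expR (- c j * x))) * x ^+ k)%:E)%E =
  (rising (alpha + 1) k * \sum_j gammaI alpha (c j) *
     (\sum_(m < n j) (L j)`_m * rising (alpha + 1 + k%:R) m / c j ^+ (m + k)))%:E.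
Proof.
move=> a1 c0 sL; pose W j m x := (L j)`_m * gweight (alpha + (m + k)%:R) (c j) x.
have am m : -1 < alpha + m%:R by apply: lt_le_trans a1 _; rewrite lerDl.
have mD : measurable (`]0%R, +oo[%classic : set R) by exact: measurable_itv.
have iW j m : mu.-integrable `]0%R, +oo[ (EFin \o W j m).
  rewrite (_ : _ \o _ =
    (fun x => ((L j)`_m)%:E * (EFin \o gweight (alpha + (m + k)%:R) (c j)) x)%E).
    by apply: integrableZl => //; exact: gweight_integrable.
  by apply/funext => x; rewrite /= EFinM.
have VE j : EFin \o (fun x => \sum_(m < n j) W j m x) =
    (fun x => (\sum_(m < n j) (EFin \o W j m) x)%E).
  by apply/funext => x; rewrite /= sumEFin.
have iV j : mu.-integrable `]0%R, +oo[ (EFin \o (fun x => \sum_(m < n j) W j m x)).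
  by rewrite VE; apply: integrable_sum => // m _; exact: iW.
have intV j : (\int[mu]_(x in `]0%R, +oo[) (EFin \o (fun x => (\sum_(m < n j) W j m x)%R)) x =
    (\sum_(m < n j)
      (L j)`_m * (gammaI alpha (c j) * rising (alpha + 1) (m + k) / c j ^+ (m + k)))%:E)%E.
  rewrite VE integral_sum//.
  rewrite -sumEFin; apply: eq_bigr => m _.
  rewrite -gammaI_rising// EFinM -gammaI_EFin// -integralZl//; last exact: gweight_integrable.
have -> : (\int[mu]_(x in `]0%R, +oo[)
     ((\sum_j (L j).[x] * (x `^ alpha * expR (- c j * x))) * x ^+ k)%:E)%E =
   (\int[mu]_(x in `]0%R, +oo[) (\sum_j (EFin \o (fun x => (\sum_(m < n j) W j m x)%R)) x))%E.
  apply: eq_integral => x; rewrite inE/= in_itv/= andbT => x0.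
  rewrite mulr_suml sumEFin; congr (_%:E); apply: eq_bigr => j _.
  rewrite (horner_coef_wide _ (sL j)) !mulr_suml; apply: eq_bigr => m _.
  rewrite /W /gweight powRD ?(gt_eqF x0) ?implybT// powR_mulrn ?(ltW x0)// exprD; ring.
rewrite integral_sum//.
under eq_bigr do rewrite intV.
rewrite sumEFin; congr (_%:E); rewrite mulr_sumr; apply: eq_bigr => j _.
rewrite mulrCA !mulr_sumr; apply: eq_bigr => m _.
by rewrite addnC risingD addnC; ring.
Qed.

Lemma typeI_orthogonality (r : nat) (n : 'I_r -> nat) (alpha : R) (c : 'I_r -> R)
    (L : 'I_r -> {poly R}) :
  -1 < alpha -> (forall j, 0 < c j) -> (0 < multi_size n)%N -> is_typeI_laguerre2 alpha c n L ->
  forall k, (k < multi_size n)%N ->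
  \sum_j gammaI alpha (c j) *
     (\sum_(m < n j) (L j)`_m * rising (alpha + 1 + k%:R) m / c j ^+ (m + k)) =
  (rising (alpha + 1) (multi_size n).-1)^-1 *+ (k == (multi_size n).-1).
Proof.
move=> a1 c0 N0 [sL h0 h1] k kN.
have r0 m : rising (alpha + 1) m != 0 by rewrite gt_eqF// rising_gt0//; lra.
apply: (mulfI (r0 k)); apply: EFin_inj; rewrite -typeI_moment//.
have [->|kN1] := eqVneq k (multi_size n).-1; first by rewrite h1 mulfV.
rewrite h0 ?mulr0n ?mulr0//.
by rewrite -ltn_predRL ltn_neqAle kN1 -ltnS prednK.
Qed.

End GammaWeight.

(** * Cluster points of zero-counting measures *)

Section TestFunctions.
Context {R : realType}.
Implicit Types (f g : (R * R)%type -> R) (v : (R * R)%type) (K T : R) (u z : R[i]).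

(* Measurability is carried along with continuity, the sigma-algebra on [R * R]
   being the product one. *)
Definition cont_meas f := continuous f /\ measurable_fun setT f.

Lemma cont_meas_cst (a : R) : cont_meas (fun=> a).
Proof. by split; [move=> v; exact: cvg_cst|exact: measurable_cst]. Qed.

Lemma cont_meas_fst : cont_meas (fun v => v.1).
Proof. by split; [move=> v; exact: cvg_fst|exact: measurable_fst]. Qed.

Lemma cont_meas_snd : cont_meas (fun v => v.2).
Proof. by split; [move=> v; exact: cvg_snd|exact: measurable_snd]. Qed.

Lemma cont_measD f g : cont_meas f -> cont_meas g -> cont_meas (fun v => f v + g v).
Proof.
move=> [cf mf] [cg mg]; split; last exact: measurable_funD.
by move=> v; apply: cvgD; [exact: cf|exact: cg].
Qed.

Lemma cont_measM f g : cont_meas f -> cont_meas g -> cont_meas (fun v => f v * g v).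
Proof.
move=> [cf mf] [cg mg]; split; last exact: measurable_funM.
by move=> v; apply: cvgM; [exact: cf|exact: cg].
Qed.

Lemma cont_measB f g : cont_meas f -> cont_meas g -> cont_meas (fun v => f v - g v).
Proof.
move=> [cf mf] [cg mg]; split; last exact: measurable_funB.
by move=> v; apply: cvgB; [exact: cf|exact: cg].
Qed.

Lemma cont_meas_norm f : cont_meas f -> cont_meas (fun v => `|f v|).
Proof.
move=> [cf mf]; split; last exact: measurableT_comp.
by move=> v; apply: cvg_norm; exact: cf.
Qed.

Lemma cont_meas_max f g : cont_meas f -> cont_meas g ->
  cont_meas (fun v => Num.max (f v) (g v)).
Proof.
move=> [cf mf] [cg mg]; split; last exact: measurable_maxr.
by move=> v; apply: continuous_max; [exact: cf|exact: cg].
Qed.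

Lemma cont_meas_min f g : cont_meas f -> cont_meas g ->
  cont_meas (fun v => Num.min (f v) (g v)).
Proof.
move=> [cf mf] [cg mg]; split; last exact: measurable_minr.
by move=> v; apply: continuous_min; [exact: cf|exact: cg].
Qed.

(** On nonnegative reals the inverse is the power of exponent -1, also at 0, where both are 0. *)
Lemma measurable_inv_ge0 f : (forall v, 0 <= f v) -> measurable_fun setT f ->
  measurable_fun setT (fun v => (f v)^-1).
Proof.
move=> f0 mf; rewrite (_ : (fun v => _) = (fun v => f v `^ (-1))).
  by apply: (measurableT_comp (f := @powR R ^~ (-1))) mf; exact: measurable_powR.
by apply/funext => v; rewrite powR_inv1.
Qed.

Lemma cont_measV f : (forall v, 1 <= f v) -> cont_meas f -> cont_meas (fun v => (f v)^-1).
Proof.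
move=> f1 [cf mf]; split; last first.
  by apply: measurable_inv_ge0 => // v; exact: le_trans (f1 v).
by move=> v; apply: cvgV; [rewrite gt_eqF// (lt_le_trans ltr01)|exact: cf].
Qed.

(** The l1 norm is built from the coordinates without square roots; [normc_taxi] and [taxi_normc]
    compare it with the modulus. *)
Definition taxi v := `|v.1| + `|v.2|.

Lemma cont_meas_taxi : cont_meas taxi.
Proof.
by apply: cont_measD; apply: cont_meas_norm; [exact: cont_meas_fst|exact: cont_meas_snd].
Qed.

Lemma test_function_taxi f T : continuous f -> (forall v, T < taxi v -> f v = 0) ->
  test_function f.
Proof.
move=> cf f0; split=> //; exists (`[- T, T] `*` `[- T, T])%classic.
  by apply: compact_setX; exact: segment_compact.
move=> v vT; apply: f0; rewrite ltNge; apply/negP => h; apply: vT.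
have h1 := normr_ge0 v.1; have h2 := normr_ge0 v.2.
by split; rewrite /= in_itv/= -ler_norml; move: h; rewrite /taxi; lra.
Qed.

(** A tent over K < [taxi v] < T, used to detect mass of the cluster point outside the region that
    contains the zeros. *)
Definition gap K T v := Num.max 0 (Num.min (taxi v - K) (T - taxi v)).

Lemma gap_ge0 K T v : 0 <= gap K T v.
Proof. by rewrite /gap le_max lexx. Qed.

Lemma cont_meas_gap K T : cont_meas (gap K T).
Proof.
apply: cont_meas_max; first exact: cont_meas_cst.
by apply: cont_meas_min; apply: cont_measB; (exact: cont_meas_taxi || exact: cont_meas_cst).
Qed.

Lemma test_function_gap K T : test_function (gap K T).
Proof.
apply: (test_function_taxi _ T); first by have [] := cont_meas_gap K T.
move=> v vT; rewrite /gap; apply/max_idPl; rewrite ge_min.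
by apply/orP; right; rewrite subr_le0 ltW.
Qed.

Lemma gap_eq0 K T v : taxi v <= K -> gap K T v = 0.
Proof. by move=> vK; apply/max_idPl; rewrite ge_min subr_le0 vK. Qed.

Lemma gap_gt0 K T v : K < taxi v -> taxi v < T -> 0 < gap K T v.
Proof. by move=> vK vT; rewrite /gap lt_max lt_min !subr_gt0 vK vT orbT. Qed.

Definition cut K v := Num.max 0 (Num.min 1 (K + 1 - taxi v)).

Lemma cont_meas_cut K : cont_meas (cut K).
Proof.
apply: cont_meas_max; first exact: cont_meas_cst.
apply: cont_meas_min; first exact: cont_meas_cst.
by apply: cont_measB; (exact: cont_meas_taxi || exact: cont_meas_cst).
Qed.

Lemma cut_eq1 K v : taxi v <= K -> cut K v = 1.
Proof.
move=> vK; rewrite /cut (min_idPl _); first by apply/max_idPr.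
by rewrite lerBrDr; lra.
Qed.

Lemma cut_eq0 K v : K + 1 < taxi v -> cut K v = 0.
Proof.
move=> vK; apply/max_idPl; rewrite ge_min; apply/orP; right.
by rewrite subr_le0 ltW.
Qed.

Definition dist2 u v := (complex.Re u - v.1) ^+ 2 + (complex.Im u - v.2) ^+ 2.

Lemma dist2_ge0 u v : 0 <= dist2 u v.
Proof. by rewrite addr_ge0 ?sqr_ge0. Qed.

Lemma cont_meas_dist2 u : cont_meas (dist2 u).
Proof.
by apply: cont_measD; apply: cont_measM; apply: cont_measB;
  (exact: cont_meas_cst || exact: cont_meas_fst || exact: cont_meas_snd).
Qed.

Lemma cauchy_kernelE u v : cauchy_kernel u v =
  ((complex.Re u - v.1) / dist2 u v) +i* (- (complex.Im u - v.2) / dist2 u v).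
Proof. by rewrite /cauchy_kernel /dist2 /to_C; case: u => a b; rewrite mulNr. Qed.

(** A compactly supported continuous substitute for the real ([l] = 0) or imaginary ([l] = 1) part
    of the kernel. The maximum with 1 removes the pole and changes nothing where [taxi v] <= K if
    |u| >= K + 1, since then |u - v| >= 1. Indexing by ['I_2] lets both parts be tested
    simultaneously. *)
Definition test_kernel K u (l : 'I_2) v :=
  cut K v * ((if l == 0 then complex.Re u - v.1 else - (complex.Im u - v.2))
             / Num.max (dist2 u v) 1).

Definition kernel_part u (l : 'I_2) v :=
  if l == 0 then complex.Re (cauchy_kernel u v) else complex.Im (cauchy_kernel u v).

Lemma cont_meas_test_kernel K u l : cont_meas (test_kernel K u l).
Proof.
apply: cont_measM; first exact: cont_meas_cut.
apply: cont_measM; last first.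
  apply: cont_measV; first by move=> v; rewrite le_max lexx orbT.
  by apply: cont_meas_max; [exact: cont_meas_dist2|exact: cont_meas_cst].
case: (l == 0); first by apply: cont_measB; [exact: cont_meas_cst|exact: cont_meas_fst].
rewrite (_ : (fun v => _) = (fun v => v.2 - complex.Im u)).
  by apply: cont_measB; [exact: cont_meas_snd|exact: cont_meas_cst].
by apply/funext => v; rewrite opprB.
Qed.

Lemma test_function_kernel K u l : test_function (test_kernel K u l).
Proof.
apply: (test_function_taxi _ (K + 1)); first by have [] := cont_meas_test_kernel K u l.
by move=> v vK; rewrite /test_kernel cut_eq0// mul0r.
Qed.

Lemma normc_taxi v : normc (to_C v) <= taxi v.
Proof. by have := normc_le_ReIm (to_C v). Qed.

Lemma taxi_normc z : taxi (to_plane z) <= 2 * normc z.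
Proof.
by rewrite /taxi/=; have := Re_le_normc z; have := Im_le_normc z; lra.
Qed.

Lemma test_kernelE K u l v : K + 1 <= normc u -> taxi v <= K ->
  test_kernel K u l v = kernel_part u l v.
Proof.
move=> uK vK; have d1 : 1 <= dist2 u v.
  have : 1 <= normc (u - to_C v).
    by have := normcB_ge u (to_C v); have := normc_taxi v; lra.
  rewrite /normc /to_C /dist2; case: u {uK} => a b /=; rewrite -{1}sqrtr1 ler_sqrt//.
  by rewrite addr_ge0 ?sqr_ge0.
rewrite /test_kernel /kernel_part cut_eq1// mul1r (max_idPl d1) cauchy_kernelE.
by case: (l == 0).
Qed.

Lemma measurable_kernel_part u l : measurable_fun setT (kernel_part u l).
Proof.
rewrite (_ : kernel_part u l = fun v =>
  (if l == 0 then complex.Re u - v.1 else v.2 - complex.Im u) * (dist2 u v)^-1).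
  apply: measurable_funM; last first.
    by apply: measurable_inv_ge0; [exact: dist2_ge0|have [] := cont_meas_dist2 u].
  case: (l == 0).
    by have [] : cont_meas (fun v => complex.Re u - v.1) by
      apply: cont_measB; [exact: cont_meas_cst|exact: cont_meas_fst].
  by have [] : cont_meas (fun v => v.2 - complex.Im u) by
    apply: cont_measB; [exact: cont_meas_snd|exact: cont_meas_cst].
apply/funext => v; rewrite /kernel_part cauchy_kernelE /=.
by case: (l == 0); rewrite // opprB.
Qed.

Lemma test_kernel_bounded K u l : exists B, forall v, `|test_kernel K u l v| <= B.
Proof.
exists (`|complex.Re u| + `|complex.Im u| + `|K| + 1) => v.
have [vK|vK] := ltP (K + 1) (taxi v).
  by rewrite /test_kernel cut_eq0// mul0r normr0 !addr_ge0.
rewrite /test_kernel !normrM.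
have c1 : `|cut K v| <= 1.
  by rewrite ger0_norm /cut ?le_max ?lexx// ge_max ler01 ge_min lexx.
have m1 : `|(Num.max (dist2 u v) 1)^-1| <= 1.
  have m1 : 1 <= Num.max (dist2 u v) 1 by rewrite le_max lexx orbT.
  by rewrite normfV ger0_norm ?invf_le1 ?(lt_le_trans ltr01)// (le_trans ler01).
rewrite -[leRHS]mul1r; apply: ler_pM; rewrite ?mulr_ge0//.
rewrite -[leRHS]mulr1; apply: ler_pM; rewrite //.
have h1 := ler_normB (complex.Re u) v.1; have h2 := ler_normB (complex.Im u) v.2.
have h3 := normr_ge0 v.1; have h4 := normr_ge0 v.2; have h5 := ler_norm K.
have h6 := normr_ge0 (complex.Re u); have h7 := normr_ge0 (complex.Im u).
by move: vK; rewrite /taxi; case: (l == 0); rewrite ?normrN; lra.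
Qed.

End TestFunctions.

(** * Integrals against zero-counting measures and their cluster points *)

Section Accumulation.
Context {R : realType}.
Implicit Types (f : (R * R)%type -> R) (u z : R[i]) (p : {poly R[i]}).

Lemma zero_counting_ge0_integral p (g : (R * R)%type -> \bar R) :
  measurable_fun setT g -> (forall v, 0 <= g v)%E ->
  (\int[zero_counting p]_v g v =
   ((size (zeros p))%:R^-1)%:E * \sum_(k < size (zeros p)) g (to_plane (zeros p)`_k))%E.
Proof.
move=> mg g0; rewrite /zero_counting ge0_integral_mscale//; congr (_ * _)%E.
rewrite ge0_integral_measure_sum//; apply: eq_bigr => k _.
by rewrite integral_dirac// diracT mul1e.
Qed.

Lemma zero_counting_Rintegral p f : measurable_fun setT f ->
  \int[zero_counting p]_v f v =
    (size (zeros p))%:R^-1 * \sum_(k < size (zeros p)) f (to_plane (zeros p)`_k).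
Proof.
move=> mf; have mEf : measurable_fun setT (EFin \o f) by exact/measurable_EFinP.
rewrite /Rintegral integralE.
rewrite zero_counting_ge0_integral; [|exact: measurable_funepos|by []].
rewrite zero_counting_ge0_integral; [|exact: measurable_funeneg|by []].
pose fp v := Num.max (f v) 0; pose fn v := Num.max (- f v) 0.
rewrite (eq_bigr (fun k => (fp (to_plane (zeros p)`_(nat_of_ord k)))%:E)); last first.
  by move=> k _; rewrite funeposE /= /fp EFin_max.
rewrite [X in (_ - _ * X)%E](eq_bigr (fun k => (fn (to_plane (zeros p)`_(nat_of_ord k)))%:E)); last first.
  by move=> k _; rewrite funenegE /= /fn EFin_max.
rewrite !sumEFin -!EFinM -EFinB/= -mulrBr -sumrB; congr (_ * _); apply: eq_bigr => k _.
rewrite /fp /fn; set y := f _.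
have [y0|y0] := leP 0 y.
  by rewrite (max_idPr _) ?oppr_le0// subr0.
by rewrite (max_idPl _) ?oppr_ge0 ?(ltW y0)// sub0r opprK.
Qed.

Section Limit.
Variables (p : nat -> {poly R[i]}) (mu : {finite_measure set (R * R)%type -> \bar R}) (K : R).
Hypothesis mu_limit : weak_star_accumulation (fun k => zero_counting (p k)) mu.
Hypothesis zeros_le : \forall k \near \oo, forall z, z \in zeros (p k) -> taxi (to_plane z) <= K.

Lemma zeros_nth_le k j : (forall z, z \in zeros (p k) -> taxi (to_plane z) <= K) ->
  (j < size (zeros (p k)))%N -> taxi (to_plane (zeros (p k))`_j) <= K.
Proof. by move=> h js; apply: h; rewrite mem_nth. Qed.

(** For large k the tent vanishes at all the zeros of [p k], so the cluster property makes its
    integral against [mu] smaller than every e > 0. *)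
Lemma mu_gap_integral T : \int[mu]_v gap K T v = 0.
Proof.
apply/eqP; rewrite -normr_eq0; apply/eqP/le_anti; rewrite normr_ge0 andbT.
apply/ler_addgt0Pr => e e0; rewrite add0r.
have [N _ hN] := zeros_le.
have [k Nk /(_ ord0)] := mu_limit 1 (fun=> gap K T) (fun=> test_function_gap K T) e e0 N.
rewrite zero_counting_Rintegral; last by have [] := cont_meas_gap K T.
rewrite big1; last by move=> j _; apply: gap_eq0; apply: zeros_nth_le => //; exact: hN.
by rewrite mulr0 sub0r normrN => /ltW.
Qed.

Lemma bounded_integrable f : measurable_fun setT f -> (exists B, forall v, `|f v| <= B) ->
  mu.-integrable setT (EFin \o f).
Proof.
move=> mf [B fB]; apply: measurable_bounded_integrable => //.
- exact: fin_num_fun_lty.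
- by exists B; split; [exact: num_real|move=> x Bx v _; exact: le_trans (fB v) (ltW Bx)].
Qed.

(** A nonnegative function of integral 0 vanishes almost everywhere, and the countably many tents
    with T = m together are positive wherever [taxi v] > K. *)
Lemma mu_supported : {ae mu, forall v, taxi v <= K}.
Proof.
have H (m : nat) : {ae mu, forall v, gap K m%:R v = 0}.
  have [cg mg] := cont_meas_gap K m%:R.
  have ig : mu.-integrable setT (EFin \o gap K m%:R).
    apply: bounded_integrable => //; exists (`|K| + m%:R) => v.
    rewrite ger0_norm ?gap_ge0// /gap ge_max ?addr_ge0//= ge_min.
    have h1 : 0 <= taxi v by rewrite addr_ge0.
    have h2 := normr_ge0 K; apply/orP; right; lra.
  have : (\int[mu]_(v in setT) `|(gap K m%:R v)%:E| = 0)%E.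
    under eq_integral do rewrite gee0_abs ?lee_fin ?gap_ge0//.
    have := mu_gap_integral m%:R; rewrite /Rintegral => h.
    by rewrite -[LHS]fineK ?h//; exact: integrable_fin_num ig.
  have [h _] := ae_eq_integral_abs mu measurableT ((measurable_EFinP _ _).2 mg).
  by move/h; apply: filterS => v /(_ I) [].
have h := ae_foralln H; apply: filterS h => v hv.
rewrite leNgt; apply/negP => Kv.
have := gap_gt0 K (Num.truncn (taxi v)).+1%:R v Kv (truncnS_gt _).
by rewrite hv ltxx.
Qed.

Lemma kernel_test_ae u l : K + 1 <= normc u ->
  ae_eq mu setT (EFin \o kernel_part u l) (EFin \o test_kernel K u l).
Proof.
move=> uK; apply: filterS mu_supported => v vK _ /=.
by rewrite test_kernelE.
Qed.

Lemma kernel_part_integrable u l : K + 1 <= normc u ->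
  mu.-integrable setT (EFin \o kernel_part u l).
Proof.
move=> uK; have [_ mt] := cont_meas_test_kernel K u l.
have mk := measurable_kernel_part u l.
have it : mu.-integrable setT (EFin \o test_kernel K u l).
  by apply: bounded_integrable => //; exact: test_kernel_bounded.
apply/integrableP; split; first exact/measurable_EFinP.
have /integrableP[_] := it; congr (_ < _)%E; apply: ae_eq_integral => //.
- by apply: measurableT_comp => //; exact/measurable_EFinP.
- by apply: measurableT_comp => //; exact/measurable_EFinP.
- by apply: filterS (kernel_test_ae u l uK) => v /(_ I) [h] _ /=; rewrite h.
Qed.

Lemma kernel_part_Rintegral u l : K + 1 <= normc u ->
  \int[mu]_v kernel_part u l v = \int[mu]_v test_kernel K u l v.
Proof.
move=> uK; have [_ mt] := cont_meas_test_kernel K u l.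
have mk := measurable_kernel_part u l.
rewrite /Rintegral; congr fine; apply: ae_eq_integral => //.
- exact/measurable_EFinP.
- exact/measurable_EFinP.
- exact: kernel_test_ae.
Qed.

(** The Cauchy transform of the zero-counting measure, as a finite sum. *)
Definition root_mean (q : {poly R[i]}) u :=
  (size (zeros q))%:R^-1 * \sum_(z <- zeros q) (u - z)^-1.

Lemma root_mean_part q u l : K + 1 <= normc u ->
  (forall z, z \in zeros q -> taxi (to_plane z) <= K) ->
  \int[zero_counting q]_v test_kernel K u l v =
    if l == 0 then complex.Re (root_mean q u) else complex.Im (root_mean q u).
Proof.
move=> uK hq; rewrite zero_counting_Rintegral; last by have [] := cont_meas_test_kernel K u l.
rewrite /root_mean (big_nth 0) big_mkord.
have -> : (size (zeros q))%:R^-1 = ((size (zeros q))%:R^-1)%:C :> R[i].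
  by rewrite fmorphV rmorph_nat.
have E (k : 'I_(size (zeros q))) : test_kernel K u l (to_plane (zeros q)`_k) =
    if l == 0 then complex.Re ((u - (zeros q)`_k)^-1) else complex.Im ((u - (zeros q)`_k)^-1).
  rewrite test_kernelE//; last by apply: hq; rewrite mem_nth.
  by rewrite /kernel_part /cauchy_kernel /to_C /to_plane/=; case: (_`_k).
under eq_bigr do rewrite E.
have reM (a : R) (z : R[i]) : complex.Re (a%:C * z) = a * complex.Re z.
  by case: z => x y /=; rewrite mul0r subr0.
have imM (a : R) (z : R[i]) : complex.Im (a%:C * z) = a * complex.Im z.
  by case: z => x y /=; rewrite mul0r addr0.
have reD (y z : R[i]) : complex.Re (y + z) = complex.Re y + complex.Re z by case: y z => ? ? [].
have imD (y z : R[i]) : complex.Im (y + z) = complex.Im y + complex.Im z by case: y z => ? ? [].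
case: (l == 0); rewrite ?reM ?imM; congr (_ * _).
  by elim/big_rec2: _ => // k x y _ ->; rewrite reD.
by elim/big_rec2: _ => // k x y _ ->; rewrite imD.
Qed.

(** For each m the cluster property, applied to both parts of the kernel with tolerance 1 / (m + 1),
    supplies an index beyond m and beyond the threshold of [zeros_le]. The resulting [phi] need not
    be monotone; [phi k] >= k suffices for passing to limits. *)
Lemma accumulation_cauchy u : K + 1 <= normc u ->
  cauchy_integrable mu u /\
  exists phi : nat -> nat, (forall k, (k <= phi k)%N) /\
    ccvg (fun k => root_mean (p (phi k)) u) (cauchy_transform mu u).
Proof.
move=> uK; split.
  by split; [exact: (kernel_part_integrable u ord0)|exact: (kernel_part_integrable u ord_max)].
have main (m : nat) : exists k, (m <= k)%N /\
    normc (root_mean (p k) u - cauchy_transform mu u) <= 2 * m.+1%:R^-1.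
  have [N _ hN] := zeros_le.
  have e0 : 0 < m.+1%:R^-1 :> R by rewrite invr_gt0.
  have [k Nk hk] := mu_limit 2 (test_kernel K u) (test_function_kernel K u) _ e0 (maxn m N).
  have Nk' : (N <= k)%N by rewrite (leq_trans _ Nk)// leq_maxr.
  exists k; split; first by rewrite (leq_trans _ Nk)// leq_maxl.
  have h0 := hk ord0; have h1 := hk ord_max.
  rewrite root_mean_part// -?kernel_part_Rintegral// in h0; last exact: hN.
  rewrite root_mean_part// -?kernel_part_Rintegral// in h1; last exact: hN.
  apply: le_trans (normc_le_ReIm _) _.
  rewrite mulrDl mul1r; apply: lerD; apply: ltW.
    by move: h0; rewrite /= /cauchy_transform /kernel_part/=; case: (root_mean _ _).
  by move: h1; rewrite /= /cauchy_transform /kernel_part/=; case: (root_mean _ _).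
have [phi hphi] := choice main; exists phi; split; first by move=> k; have [] := hphi k.
apply: (@ccvg_le _ _ _ (fun m => 2 * m.+1%:R^-1)).
  by near=> k; have [] := hphi k.
rewrite -(mulr0 2); apply: cvgM; first exact: cvg_cst.
exact: cvg_harmonic.
Unshelve. all: by end_near. Qed.

End Limit.
End Accumulation.

(** * The limit equation *)

Lemma map_appell {F K : fieldType} (f : {rmorphism F -> K}) t (g : {poly F}) m :
  map_poly f (appell t g m) = appell (f t) (map_poly f g) m.
Proof.
rewrite /appell rmorph_sum/=; apply: eq_bigr => k _.
by rewrite map_polyZ map_polyXn !rmorphM rmorphXn rmorphN rmorph_nat coef_map.
Qed.

Lemma eqmodX_map {F K : fieldType} (f : {rmorphism F -> K}) m (p q : {poly F}) :
  eqmodX m p q -> eqmodX m (map_poly f p) (map_poly f q).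
Proof. by move=> pq k km; rewrite !coef_map/= pq. Qed.

(** In the coefficient of x^m, the falling factorial of the operator and the m! of [coefrev]
    multiply to M!, while (-1)^m (- 1 / nu)^(M - m) becomes nu^m after multiplication by (- nu)^M.
    This is the origin of the constant. *)
Lemma typeI_appell {R : numFieldType} n (l : {poly R}) (nu : R) :
  (0 < n)%N -> (size l <= n)%N -> nu != 0 ->
  exists2 C, C != 0 & l \Po (nu *: 'X) = C *: appell nu^-1 (coefrev n l) n.-1.
Proof.
case: n => // M _ sl nu0; exists ((- nu) ^+ M / M`!%:R).
  by rewrite mulf_neq0 ?expf_neq0 ?oppr_eq0// invr_eq0 factS_neq0.
have -> : l \Po (nu *: 'X) = \poly_(k < size l) (l`_k * nu ^+ k).
  by rewrite comp_polyE poly_def; apply: eq_bigr => k _; rewrite exprZn scalerA.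
apply/polyP => m; rewrite coefZ coef_poly.
have [mM|Mm] := leqP m M; last first.
  rewrite ltnNge (leq_trans sl)//= [X in _ * X]nth_default ?mulr0//.
  exact: leq_trans (size_appell_leq _ _ _) Mm.
have -> : (appell nu^-1 (coefrev M.+1 l) M)`_m =
    (-1) ^+ m * m`!%:R * l`_m * (- nu^-1) ^+ (M - m) * (M ^_ (M - m))%:R.
  by rewrite -{1}(subKn mM) coef_appell ?leq_subr// coef_poly ltnS leq_subr/= subKn.
have fM : (M ^_ (M - m))%:R * m`!%:R = M`!%:R :> R.
  by rewrite -natrM -(ffact_fact (leq_subr m M)) subKn.
have -> : (if (m < size l)%N then l`_m * nu ^+ m else 0) = l`_m * nu ^+ m.
  by case: ltnP => // h; rewrite nth_default// mul0r.
rewrite -fM -{1}(subnK mM) addnC exprD.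
have h1 : (- nu) ^+ (M - m) * (- nu^-1) ^+ (M - m) = 1.
  by rewrite -exprMn mulrNN divff// expr1n.
have h2 : (- nu) ^+ m * (-1) ^+ m = nu ^+ m by rewrite -exprMn mulrN1 opprK.
have m0 : m`!%:R != 0 :> R by exact: factS_neq0.
have f0 : (M ^_ (M - m))%:R != 0 :> R by rewrite pnatr_eq0 -lt0n ffact_gt0 leq_subr.
transitivity (((- nu) ^+ (M - m) * (- nu^-1) ^+ (M - m)) * ((- nu) ^+ m * (-1) ^+ m) * l`_m).
  by rewrite h1 h2 mul1r mulrC.
move: ((- nu) ^+ (M - m)) ((- nu^-1) ^+ (M - m)) ((- nu) ^+ m) ((-1) ^+ m : R) => x y z w.
by move: (l`_m) (m`!%:R : R) ((M ^_ (M - m))%:R : R) m0 f0 => a f h f0 h0; field; rewrite f0 h0.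
Qed.

(** * The system attached to a single multi-index *)

Section OneIndex.
Context {R : realType} {r : nat}.
Variables (n : 'I_r -> nat) (alpha : R) (c : 'I_r -> R) (L : 'I_r -> {poly R}) (i : 'I_r)
  (eps Bd : R).
Hypotheses (n_gt0 : forall j, (0 < n j)%N) (alpha_gt : -1 < alpha)
  (c_gt0 : forall j, 0 < c j) (c_inj : injective c).
Hypothesis L_typeI : is_typeI_laguerre2 alpha c n L.
Hypothesis eps_le : forall j, eps <= `|lshift_node c i j|.
Hypothesis Bd_ge : \sum_j `|(n i)%:R^-1 * lshift_exp n alpha i j| <= Bd.
Hypothesis eps_gt0 : 0 < eps.

Let g := coefrev (n i) (L i).
Let gC := complex_poly g.
Let bC j := complex_poly (invXD (n i) (lshift_node c i j) * g).
Let t : R[i] := ((n i)%:R^-1)%:C.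
Let M := (n i).-1.
Let q := complex_poly (L i \Po ((n i)%:R *: 'X)).

Lemma typeI_system : logderiv_system M t (fun j => (lshift_node c i j)%:C)
  (fun j => (lshift_exp n alpha i j)%:C) gC bC eps Bd.
Proof.
have N0 : (0 < multi_size n)%N by rewrite /multi_size (bigD1 i)//= ltn_addr.
have cn0 j : c j != 0 by rewrite gt_eqF.
have w0 : gammaI alpha (c i) != 0 by rewrite gt_eqF// gammaI_gt0.
have k0 : (rising (alpha + 1) (multi_size n).-1)^-1 != 0.
  by rewrite invr_eq0 gt_eqF// rising_gt0//; have := alpha_gt; lra.
have orth := typeI_orthogonality _ _ _ _ _ alpha_gt c_gt0 N0 L_typeI.
have bg j : eqmodX (n i) (('X + (lshift_node c i j)%:P) * (invXD (n i) (lshift_node c i j) * g)) g.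
  rewrite mulrA -[X in eqmodX _ _ X]mul1r; apply: eqmodXM => //.
  by apply: invXDE; exact: lshift_node_neq0.
split; last first.
  move=> m mM; rewrite /t -(rmorph_nat (real_complex R)) -rmorphM normc_real.
  rewrite ger0_norm ?mulr_ge0 ?invr_ge0// ler_pdivrMl ?ltr0n// mulr1 ler_nat.
  by rewrite (leq_trans mM)// leq_pred.
split.
- rewrite coef_map fmorph_eq0.
  exact: (coefrev0_neq0 c n alpha i n_gt0 cn0 L _ _ w0 k0 orth).
- move=> j; rewrite prednK//.
  have := eqmodX_map (real_complex R) _ _ _ (bg j).
  by rewrite rmorphM/= rmorphD/= map_polyX map_polyC.
- have bg' j : eqmodX (n i).-1.+1
      (('X + (lshift_node c i j)%:P) * (invXD (n i) (lshift_node c i j) * g)) g.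
    by rewrite prednK.
  have h := coefrev_logderiv c n alpha i n_gt0 cn0 c_inj L _ _ w0 orth _ bg'.
  have := eqmodX_map (real_complex R) _ _ _ h.
  rewrite deriv_map rmorph_sum/=; congr (eqmodX _ _ _).
  by apply: eq_bigr => j _; rewrite map_polyZ.
- by move=> j; rewrite normc_real.
- rewrite (eq_bigr (fun j => `|(n i)%:R^-1 * lshift_exp n alpha i j|))// => j _.
  by rewrite /t -rmorphM normc_real.
Qed.

Lemma typeI_factor : exists2 C, C != 0 & q = C *: appell t gC M.
Proof.
have n0 : (n i)%:R != 0 :> R by rewrite pnatr_eq0 -lt0n.
have [sL _ _] := L_typeI.
have [C C0 E] := typeI_appell _ _ _ (n_gt0 i) (sL i) n0.
exists C%:C; first by rewrite fmorph_eq0.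
by rewrite /q /complex_poly E map_polyZ map_appell.
Qed.

Lemma typeI_zeros_lt z : z \in zeros q -> normc z < root_radius eps Bd.
Proof.
have [C C0 E] := typeI_factor.
rewrite /zeros; case: closed_field_poly_normal => zs /= h zz.
apply: (appell_root_lt _ _ _ _ _ _ _ _ eps_gt0 typeI_system _ _ (leqnn M)).
have : root q z.
  rewrite h rootZ ?root_prod_XsubC// lead_coef_eq0 E scaler_eq0 negb_or C0/=.
  by rewrite -size_poly_eq0 size_appell//; case: typeI_system => -[].
by rewrite E rootZ.
Qed.

Lemma typeI_root_mean u : root_radius eps Bd <= normc u -> (0 < M)%N ->
  root_mean q u = (appell t gC M.-1).[u] / (appell t gC M).[u].
Proof.
move=> uK M0; have [C C0 E] := typeI_factor.
have g0 : gC`_0 != 0 by case: typeI_system => -[].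
rewrite /root_mean /zeros; case: closed_field_poly_normal => zs /= h.
have lcE : lead_coef (appell t gC M) = gC`_0.
  rewrite lead_coefE size_appell//=.
  by have := coef_appell t gC M 0 isT; rewrite subn0 ffactn0 expr0 !mulr1.
have h' : appell t gC M = gC`_0 *: \prod_(z <- zs) ('X - z%:P).
  by apply: (scalerI C0); rewrite -E h E lead_coefZ lcE scalerA.
have szs : size zs = M.
  have : size (appell t gC M) = M.+1 by exact: size_appell.
  by rewrite h' size_scale// size_prod_XsubC => -[].
have ltM : (M.-1 < M)%N by rewrite prednK.
have h'' : appell t gC M.-1.+1 = gC`_0 *: \prod_(z <- zs) ('X - z%:P) by rewrite prednK.
have := ratio_sum_roots _ _ _ _ _ _ _ _ eps_gt0 typeI_system u _ zs uK ltM h''.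
by rewrite szs prednK// => <-; rewrite mulKf// pnatr_eq0 -lt0n.
Qed.

End OneIndex.

Lemma cvg_subseq {T : Type} (F : set_system T) (u : nat -> T) (phi : nat -> nat) :
  (forall k, (k <= phi k)%N) -> u @ \oo --> F -> (fun k => u (phi k)) @ \oo --> F.
Proof.
move=> kphi uF B FB; have [N _ NB] := uF B FB.
by exists N => // k Nk; apply: NB; exact: leq_trans Nk (kphi k).
Qed.

Lemma sum_cvg {R : realType} (I : Type) (s : seq I) (u : I -> nat -> R) (l : I -> R) :
  (forall j, u j @ \oo --> l j) ->
  (fun k => \sum_(j <- s) u j k) @ \oo --> \sum_(j <- s) l j.
Proof.
move=> ul; elim: s => [|j s IH].
  by rewrite big_nil; under eq_fun do rewrite big_nil; exact: cvg_cst.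
by rewrite big_cons; under eq_fun do rewrite big_cons; exact: cvgD.
Qed.

(** * Limits of the parameters and uniform constants *)

Section Asymptotics.
Context {R : realType} {r : nat}.
Variables (n : nat -> 'I_r -> nat) (alpha : nat -> R) (c : nat -> 'I_r -> R)
  (A : R) (theta climit : 'I_r -> R) (i : 'I_r).
Hypothesis n_gt0 : forall k j, (0 < n k j)%N.
Hypothesis n_infty : (fun k => multi_size (n k)) @ \oo --> \oo.
Hypothesis alpha_cvg : (fun k => alpha k / (multi_size (n k))%:R) @ \oo --> A.
Hypothesis theta_gt0 : forall j, 0 < theta j.
Hypothesis n_cvg : forall j,
  (fun k => (n k j)%:R / (multi_size (n k))%:R) @ \oo --> theta j.
Hypothesis c_cvg : forall j, (fun k => c k j) @ \oo --> climit j.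

Let N k := multi_size (n k).

Lemma multi_size_neq0 k : (N k)%:R != 0 :> R.
Proof. by rewrite pnatr_eq0 -lt0n /N /multi_size (bigD1 i)//= ltn_addr. Qed.

Lemma lshift_node_cvg j : (fun k => lshift_node (c k) i j) @ \oo --> lshift_node climit i j.
Proof.
rewrite /lshift_node; case: (j == i); first exact: c_cvg.
by apply: cvgB; exact: c_cvg.
Qed.

(** The b_j of the introduction: (alpha + N - 1) / n_i tends to (A + 1) / theta_i, and n_j / n_i to
    theta_j / theta_i. *)
Definition exp_lim j : R := if j == i then (A + 1) / theta i else - (theta j / theta i).

Lemma lshift_exp_cvg j :
  (fun k => (n k i)%:R^-1 * lshift_exp (n k) (alpha k) i j) @ \oo --> exp_lim j.
Proof.
have th0 : theta i != 0 by rewrite gt_eqF.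
have inv_cvg : (fun k => ((n k i)%:R / (N k)%:R)^-1) @ \oo --> (theta i)^-1.
  by apply: cvgV => //; exact: n_cvg.
rewrite /lshift_exp /exp_lim; case: (j == i); last first.
  have -> : (fun k => (n k i)%:R^-1 * - (n k j)%:R) =
      (fun k => - ((n k j)%:R / (N k)%:R) * ((n k i)%:R / (N k)%:R)^-1) :> (nat -> R).
    apply/funext => k; have h := multi_size_neq0 k; field.
    by rewrite h pnatr_eq0 -lt0n n_gt0.
  rewrite -[X in _ --> X]mulNr.
  by apply: cvgM => //; apply: cvgN; exact: n_cvg.
have -> : (fun k => (n k i)%:R^-1 * (alpha k + (\sum_j n k j)%N%:R - 1)) =
    (fun k => (alpha k / (N k)%:R + 1 - 1 / (N k)%:R) * ((n k i)%:R / (N k)%:R)^-1).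
  apply/funext => k; have h := multi_size_neq0 k; rewrite -/(multi_size _) -/(N k); field.
  by rewrite h pnatr_eq0 -lt0n n_gt0.
apply: cvgM => //; rewrite -[A + 1]subr0; apply: cvgB; last exact: cst_div_nat_cvg0.
by apply: cvgD => //; exact: cvg_cst.
Qed.

Lemma inv_index_cvg0 : (fun k => ((n k i)%:R^-1 : R)) @ \oo --> (0 : R).
Proof.
have th0 : theta i != 0 by rewrite gt_eqF.
have -> : (fun k => (n k i)%:R^-1) =
    (fun k => 1 / (N k)%:R * ((n k i)%:R / (N k)%:R)^-1) :> (nat -> R).
  apply/funext => k; have h := multi_size_neq0 k; field.
  by rewrite h pnatr_eq0 -lt0n n_gt0.
rewrite -(mul0r (theta i)^-1); apply: cvgM; first exact: cst_div_nat_cvg0.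
by apply: cvgV => //; exact: n_cvg.
Qed.

Lemma index_pred_infty : (fun k => (n k i).-1) @ \oo --> \oo.
Proof.
move=> B [l _ lB].
have e0 : 0 < l.+1%:R^-1 :> R by rewrite invr_gt0.
move/cvgrPdist_lt : inv_index_cvg0 => /(_ _ e0); apply: filterS => k.
rewrite sub0r normrN ger0_norm ?invr_ge0// ltf_pV2 ?posrE ?ltr0n// ltr_nat => h.
by apply: lB => /=; rewrite -ltnS prednK// ltnW.
Qed.

Lemma index_ratio_cvg1 : (fun k => (n k i)%:R^-1 * (n k i).-1%:R) @ \oo --> (1 : R).
Proof.
have -> : (fun k => (n k i)%:R^-1 * (n k i).-1%:R) = (fun k => 1 - (n k i)%:R^-1) :> (nat -> R).
  apply/funext => k; rewrite -subn1 natrB// mulrBr mulr1 mulVf//.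
  by rewrite pnatr_eq0 -lt0n.
rewrite -[X in _ --> X](subr0 (1 : R)); apply: cvgB; first exact: cvg_cst.
exact: inv_index_cvg0.
Qed.

(** The inverse of the sum of the inverses is a positive lower bound for all the limit nodes, in
    place of their minimum. Halving makes the bound strict, so that it persists for the nodes of
    [c k] with k large. *)
Definition node_gap := (\sum_j `|lshift_node climit i j|^-1)^-1 / 2.

Definition exp_bound := \sum_j `|exp_lim j| + 1.

Hypothesis node_lim_neq0 : forall j, lshift_node climit i j != 0.

Lemma node_sum_gt0 : 0 < \sum_j `|lshift_node climit i j|^-1.
Proof.
rewrite (bigD1 i)//= ltr_pwDl ?invr_gt0 ?normr_gt0//.
by apply: sumr_ge0 => j _; rewrite invr_ge0.
Qed.

Lemma node_gap_gt0 : 0 < node_gap.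
Proof. by rewrite divr_gt0// invr_gt0 node_sum_gt0. Qed.

Lemma node_gap_lt j : node_gap < `|lshift_node climit i j|.
Proof.
have s0 := node_sum_gt0; have n0 : 0 < `|lshift_node climit i j| by rewrite normr_gt0.
apply: (@lt_le_trans _ _ (\sum_j `|lshift_node climit i j|^-1)^-1).
  by rewrite /node_gap ltr_pdivrMr// ltr_pMr ?invr_gt0// ltr1n.
rewrite invf_ple ?posrE// (bigD1 j)//= lerDl.
by apply: sumr_ge0 => l _; rewrite invr_ge0.
Qed.

Lemma near_node_gap : \forall k \near \oo, forall j, node_gap <= `|lshift_node (c k) i j|.
Proof.
apply: filter_forall => j.
have h : (fun k => `|lshift_node (c k) i j|) @ \oo --> `|lshift_node climit i j|.
  by apply: cvg_norm; exact: lshift_node_cvg.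
by apply: (cvgr_ge _ h); exact: node_gap_lt.
Qed.

Lemma near_exp_bound : \forall k \near \oo,
  \sum_j `|(n k i)%:R^-1 * lshift_exp (n k) (alpha k) i j| <= exp_bound.
Proof.
have h : (fun k => \sum_j `|(n k i)%:R^-1 * lshift_exp (n k) (alpha k) i j|) @ \oo -->
    \sum_j `|exp_lim j|.
  by apply: sum_cvg => j; apply: cvg_norm; exact: lshift_exp_cvg.
by apply: (cvgr_le _ h); rewrite /exp_bound ltrDl.
Qed.

End Asymptotics.

Theorem theorem4p10 (R : realType) (r : nat)
    (n : nat -> 'I_r -> nat) (alpha : nat -> R) (c : nat -> 'I_r -> R)
    (A : R) (theta climit : 'I_r -> R)
    (n_gt0 : forall k j, (0 < n k j)%N)
    (n_infty : (fun k => multi_size (n k)) @ \oo --> \oo)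
    (alpha_gt : forall k, -1 < alpha k)
    (A_ge0 : 0 <= A)
    (alpha_cvg : (fun k => alpha k / (multi_size (n k))%:R) @ \oo --> A)
    (theta_gt0 : forall j, 0 < theta j)
    (n_cvg : forall j,
       (fun k => (n k j)%:R / (multi_size (n k))%:R) @ \oo --> theta j)
    (c_gt0 : forall k j, 0 < c k j)
    (c_inj : forall k, injective (c k))
    (climit_gt0 : forall j, 0 < climit j)
    (climit_inj : injective climit)
    (c_cvg : forall j, (fun k => c k j) @ \oo --> climit j)
    (i : 'I_r)
    (L : nat -> 'I_r -> {poly R})
    (L_typeI : forall k, is_typeI_laguerre2 (alpha k) (c k) (n k) (L k))
    (mu : {finite_measure set (R * R)%type -> \bar R})
    (mu_limit : weak_star_accumulation
       (fun k => zero_counting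
          (complex_poly (L k i \Po ((n k i)%:R *: 'X)))) mu) :
  exists2 M : R, 0 < M & forall u : R[i], M%:C < `|u| ->
    cauchy_integrable mu u /\
    let y := cauchy_transform mu u in
    [/\ y != 0,
        forall j, j != i -> y - (climit i)%:C + (climit j)%:C != 0,
        y - (climit i)%:C != 0 &
        u = y^-1 - (A + 1)%:C / ((theta i)%:C * (y - (climit i)%:C))
            + \sum_(j < r | j != i)
                (theta j)%:C
                / ((theta i)%:C * (y - (climit i)%:C + (climit j)%:C))].
Proof.
have climit0 j : climit j != 0 by rewrite gt_eqF.
have node0 j : lshift_node climit i j != 0 by exact: lshift_node_neq0.
set eps := node_gap climit i; set Bd := exp_bound A theta i.
have eps0 : 0 < eps := node_gap_gt0 climit i node0.
have Bd0 : 0 < Bd by rewrite /Bd /exp_bound ltr_wpDl// sumr_ge0.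
set rr := root_radius eps Bd.
have rr0 : 0 < rr.
  apply: addr_gt0; first by rewrite invr_gt0 divr_gt0.
  by rewrite divr_gt0// mulr_gt0.
have near_eps := near_node_gap c climit i c_cvg node0.
have near_Bd := near_exp_bound n alpha A theta i n_gt0 n_infty alpha_cvg theta_gt0 n_cvg.
have M_infty := index_pred_infty n theta i n_gt0 n_infty theta_gt0 n_cvg.
pose good k := [/\ forall j, eps <= `|lshift_node (c k) i j|,
  \sum_j `|(n k i)%:R^-1 * lshift_exp (n k) (alpha k) i j| <= Bd & (0 < (n k i).-1)%N].
have near_good : \forall k \near \oo, good k.
  by apply: filterS3 near_eps near_Bd (near_nat_ge _ 1 M_infty) => k.
pose q k := complex_poly (L k i \Po ((n k i)%:R *: 'X)).
(* The factor 2 is the price of passing from the modulus to the l1 norm. *)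
have zeros_le : \forall k \near \oo, forall z, z \in zeros (q k) -> taxi (to_plane z) <= 2 * rr.
  apply: filterS near_good => k [ek Bk Mk] z zk.
  apply: le_trans (taxi_normc z) _; rewrite ler_wpM2l// ltW//.
  exact: (typeI_zeros_lt (n k) (alpha k) (c k) (L k) i eps Bd (n_gt0 k) (alpha_gt k)
    (c_gt0 k) (c_inj k) (L_typeI k) ek Bk eps0 z zk).
(* [accumulation_cauchy] needs 1 more than the l1 bound on the zeros; this also exceeds the rr + 1
   required for the limit of the system. *)
exists (2 * rr + 1); first by lra.
move=> u; rewrite normc_norm ltcR => uM.
have uK : 2 * rr + 1 <= normc u by exact: ltW.
have [int_u [phi [kphi y_cvg]]] := accumulation_cauchy q mu (2 * rr) mu_limit zeros_le u uK.
split=> //=; set y := cauchy_transform mu u in y_cvg *.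
have [N0 _ good_ge] := near_good.
(* Shifting by [N0] makes every index good, since the limit theorem asks for the system at each
   k. *)
pose psi k := phi (k + N0)%N.
have kpsi k : (k <= psi k)%N by apply: leq_trans (kphi _); rewrite leq_addr.
have good_psi k : good (psi k).
  by apply: good_ge => /=; apply: leq_trans (kphi _); rewrite leq_addl.
have ur : rr <= normc u by lra.
have ur1 : rr + 1 <= normc u by lra.
pose M k := (n (psi k) i).-1.
pose t k : R[i] := ((n (psi k) i)%:R^-1)%:C.
pose e k j : R[i] := (lshift_node (c (psi k)) i j)%:C.
pose beta k j : R[i] := (lshift_exp (n (psi k)) (alpha (psi k)) i j)%:C.
pose g k := complex_poly (coefrev (n (psi k) i) (L (psi k) i)).
pose b k j := complex_poly (invXD (n (psi k) i) (lshift_node (c (psi k)) i j)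
   * coefrev (n (psi k) i) (L (psi k) i)).
have sys k : logderiv_system (M k) (t k) (e k) (beta k) (g k) (b k) eps Bd.
  have [ek Bk Mk] := good_psi k.
  exact: (typeI_system (n (psi k)) (alpha (psi k)) (c (psi k)) (L (psi k)) i eps Bd
    (n_gt0 _) (alpha_gt _) (c_gt0 _) (c_inj _) (L_typeI _) ek Bk).
have M_cvg : M @ \oo --> \oo := cvg_subseq _ _ _ kpsi M_infty.
have t_cvg : ccvg t 0.
  exact: (ccvg_real _ _ (cvg_subseq _ _ _ kpsi
    (inv_index_cvg0 n theta i n_gt0 n_infty theta_gt0 n_cvg))).
have tM_cvg : ccvg (fun k => t k * (M k)%:R) 1.
  have := ccvg_real _ _ (cvg_subseq _ _ _ kpsi
    (index_ratio_cvg1 n theta i n_gt0 n_infty theta_gt0 n_cvg)).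
  by congr ccvg; apply/funext => k; rewrite /t /M rmorphM rmorph_nat.
have e_cvg j : ccvg (e ^~ j) (lshift_node climit i j)%:C.
  exact: ccvg_real (cvg_subseq _ _ _ kpsi (lshift_node_cvg c climit i c_cvg j)).
have beta_cvg j : ccvg (fun k => t k * beta k j) (exp_lim A theta i j)%:C.
  have := ccvg_real _ _ (cvg_subseq _ _ _ kpsi
    (lshift_exp_cvg n alpha A theta i n_gt0 n_infty alpha_cvg theta_gt0 n_cvg j)).
  by congr ccvg; apply/funext => k; rewrite rmorphM.
have ratio_cvg : ccvg (fun k =>
    (appell (t k) (g k) (M k).-1).[u] / (appell (t k) (g k) (M k)).[u]) y.
  have := cvg_subseq _ _ (fun k => (k + N0)%N) (fun k => leq_addr N0 k) y_cvg.
  congr ccvg; apply/funext => k; have [ek Bk Mk] := good_psi k.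
  exact: (typeI_root_mean (n (psi k)) (alpha (psi k)) (c (psi k)) (L (psi k)) i eps Bd
    (n_gt0 _) (alpha_gt _) (c_gt0 _) (c_inj _) (L_typeI _) ek Bk eps0 u ur Mk).
have eqn := logderiv_system_limit M t e beta g b eps Bd _ _ u y eps0 sys M_cvg t_cvg tM_cvg
  e_cvg beta_cvg ur1 ratio_cvg.
have sub0 j := e_lim_sub_neq0 M t e beta g b eps Bd _ u y eps0 sys M_cvg e_cvg ur1 ratio_cvg j.
(* For y = 0 the limit equation would read 0 = 1. *)
have y0 : y != 0.
  by apply/eqP => y0; move: eqn; rewrite y0 mulr0 mul0r addr0 => /eqP; rewrite eq_sym oner_eq0.
have yi : y - (climit i)%:C != 0.
  by have := sub0 i; rewrite /lshift_node eqxx -opprB oppr_eq0.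
have yE j : j != i -> (lshift_node climit i j)%:C - y = - (y - (climit i)%:C + (climit j)%:C).
  by move=> /negbTE ji; rewrite /lshift_node ji rmorphB; ring.
have yj j : j != i -> y - (climit i)%:C + (climit j)%:C != 0.
  by move=> ji; have := sub0 j; rewrite yE// oppr_eq0.
split=> //.
have th0 : (theta i)%:C != 0 by rewrite fmorph_eq0 gt_eqF.
(* Each e_j - y is the opposite of the denominator in the statement. For j != i this sign cancels
   that of [exp_lim]; for j = i it stays. *)
have sumE : \sum_j (exp_lim A theta i j)%:C / ((lshift_node climit i j)%:C - y) =
    - ((A + 1)%:C / ((theta i)%:C * (y - (climit i)%:C))) +
    \sum_(j < r | j != i) (theta j)%:C / ((theta i)%:C * (y - (climit i)%:C + (climit j)%:C)).
  rewrite (bigD1 i)//=; congr (_ + _).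
    rewrite /exp_lim /lshift_node eqxx -[(climit i)%:C - y]opprB fmorph_div/=.
    by field; rewrite th0 yi.
  apply: eq_bigr => j ji; rewrite yE// /exp_lim (negbTE ji) rmorphN/= fmorph_div/=.
  have := yj j ji; set w := y - _ + _ => w0.
  by field; rewrite th0 w0.
apply: (mulIf y0); rewrite eqn sumE -addrA mulrDl mulVf//; congr (_ + _).
by rewrite mulrC.
Qed.
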